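(* Let $G$ be a finite simple $2$-connected graph. If $G$ is $\{K_{1,3},N_{1,1,2},D\}$-heavy, then $G$ is Hamiltonian.
   Context: Let $G$ be a graph on $n$ vertices. An induced subgraph $H'$ of $G$ is called heavy if there exist two nonadjacent vertices in $H'$ whose degree sum in $G$ is at least $n$. For a graph $H$, $G$ is $H$-heavy if every induced subgraph of $G$ isomorphic to $H$ is heavy; for a family $\mathcal{H}$, $G$ is $\mathcal{H}$-heavy if it is $H$-heavy for every $H\in\mathcal{H}$. $K_{1,3}$ is the claw (star with three leaves). $N_{1,1,2}$ is the graph on 7 vertices obtained from a triangle $abc$ by attaching a pendant edge at $a$, a pendant edge at $b$, and a pendant path of length $2$ at $c$. $D$ (the ''deer'') is the graph on 7 vertices obtained from a triangle $abc$ by attaching a pendant path of length $2$ at $a$ and a pendant path of length $2$ at $b$ (the vertex $c$ has degree $2$). *)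

(* Defs.v *)
From mathcomp Require Import all_boot.
From Stdlib Require List.

Set Implicit Arguments.
Unset Strict Implicit.
Unset Printing Implicit Defensive.

Record sgraph := SGraph {
  vertex :> finType;
  edge : rel vertex;
  edge_sym : symmetric edge;
  edge_irrefl : irreflexive edge }.

Arguments edge {s} x y : rename.

Definition degree (G : sgraph) (x : G) : nat := #|[set y | edge x y]|.

Section Induced.
Variables (G : sgraph) (S : {set G}).

Definition induced_edge : rel {x : G | x \in S} :=
  fun u v => edge (val u) (val v).

Lemma induced_edge_sym : symmetric induced_edge.
Proof. by move=> u v; apply: edge_sym. Qed.

Lemma induced_edge_irrefl : irreflexive induced_edge.
Proof. by move=> u; apply: edge_irrefl. Qed.

Definition induced : sgraph := SGraph induced_edge_sym induced_edge_irrefl.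

End Induced.

Definition isomorphic (G H : sgraph) : Prop :=
  exists2 f : G -> H, bijective f & forall x y, edge (f x) (f y) = edge x y.

Definition connected (G : sgraph) : Prop :=
  0 < #|G| /\ forall x y : G, connect edge x y.

Definition k_connected (k : nat) (G : sgraph) : Prop :=
  k < #|G| /\ forall X : {set G}, #|X| < k -> connected (induced (~: X)).

(* The bound on the size is needed because [cycle] also holds of the empty
   sequence and of [:: x; y] for a single edge. *)
Definition hamiltonian (G : sgraph) : Prop :=
  exists c : seq G, [/\ 2 < size c, cycle edge c, uniq c & forall x, x \in c].

(* Degrees are taken in G, not in G[S]. *)
Definition heavy (G : sgraph) (S : {set G}) : Prop :=
  exists x y : G, [/\ x \in S, y \in S, x != y, ~~ edge x y &
                      #|G| <= degree x + degree y].

Definition graph_heavy (H G : sgraph) : Prop :=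
  forall S : {set G}, isomorphic (induced S) H -> heavy S.

(* [sgraph] has no decidable equality, whence [List.In] instead of [\in]. *)
Definition family_heavy (F : seq sgraph) (G : sgraph) : Prop :=
  forall H : sgraph, List.In H F -> graph_heavy H G.

Section OfEdges.
Variables (n : nat) (s : seq (nat * nat)).

Definition edges_rel : rel 'I_n := fun i j =>
  (i != j) && (((val i, val j) \in s) || ((val j, val i) \in s)).

Lemma edges_rel_sym : symmetric edges_rel.
Proof. by move=> i j; rewrite /edges_rel eq_sym orbC. Qed.

Lemma edges_rel_irrefl : irreflexive edges_rel.
Proof. by move=> i; rewrite /edges_rel eqxx. Qed.

Definition graph_of_edges : sgraph := SGraph edges_rel_sym edges_rel_irrefl.

End OfEdges.

Definition claw : sgraph := graph_of_edges 4 [:: (0, 1); (0, 2); (0, 3)].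

(* In the next two graphs the triangle abc is 0, 1, 2. *)
Definition N112 : sgraph := graph_of_edges 7
  [:: (0, 1); (1, 2); (0, 2); (0, 3); (1, 4); (2, 5); (5, 6)].

Definition deer : sgraph := graph_of_edges 7
  [:: (0, 1); (1, 2); (0, 2); (0, 3); (3, 4); (1, 5); (5, 6)].

(* Main.v *)
(** Let C be a longest cycle and suppose that it misses a vertex; let R be a
    shortest path through the outside of C between two vertices x and y of C.
    Call o-edge an edge or a pair of degree sum at least n.  By the exchange
    argument of Ore and of Bondy and Chvatal, no cycle of o-edges is longer than
    C; in particular no path of o-edges from x to y covers C exactly.  Around x,
    grow a segment X of C inside which C can be rerouted in many ways ([nice]):
    the next vertex on either side is added when it has a second o-neighbour in X,
    and the next vertices on both sides are added when they form an o-edge.  Do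
    the same around y.
    - If both segments come to contain a heavy nonadjacent pair, then the degrees
      give an o-edge between the two pairs, hence a longer cycle ([two_good]).
    - Otherwise one of them, say X, gets stuck while its heavy pairs are edges.  Its
      next vertices a, b and a vertex z of R are then pendant on X, and since there
      is no claw and no N_{1,1,2}, x and the two ends of X form a triangle
      ([stuck_triangle]).  Prolonging the pendant path at x along R produces an
      N_{1,1,2}, unless R = z and xy is an edge; then the triangle xyz produces an
      N_{1,1,2} or a deer using the successors of y on C.  That none of these
      subgraphs is heavy follows from the maximality of C; for the pair of x and the
      second vertex of R after x this takes a count of the neighbours of x on C
      ([tail_light], [ends_light]). *)

Require Import Defs.
From mathcomp Require Import all_boot zify.

Set Implicit Arguments.
Unset Strict Implicit.
Unset Printing Implicit Defensive.

(** * Heavy pairs and induced subgraphs *)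

(** The relation is not irreflexive: a vertex of degree at least half the order is related to
    itself. Distinctness has to come from [uniq] or from side conditions. *)
Definition oedge (G : sgraph) : rel G :=
  fun u v => edge u v || (#|G| <= degree u + degree v).
Arguments oedge {G} u v : simpl never.

Lemma oedge_sym (G : sgraph) : symmetric (@oedge G).
Proof. by move=> u v; rewrite /oedge edge_sym addnC. Qed.

Lemma edge_oedge (G : sgraph) (u v : G) : edge u v -> oedge u v.
Proof. by rewrite /oedge => ->. Qed.

Lemma embedding_heavy n s (G : sgraph) (f : 'I_n -> G) :
  graph_heavy (graph_of_edges n s) G -> injective f ->
  (forall i j, edge (f i) (f j) = edges_rel s i j) ->
  exists i j, [/\ i != j, ~~ edges_rel s i j & oedge (f i) (f j)].
Proof.
move=> hG f_inj fE; pose S := [set f i | i in 'I_n].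
have fS i : f i \in S by apply: imset_f.
pose g i : induced S := exist (fun x => x \in S) (f i) (fS i).
have g_inj : injective g by move=> i j /(congr1 val); apply: f_inj.
have [h gK hK] : bijective g.
  apply: inj_card_bij g_inj _; rewrite card_sig.
  exact: leq_imset_card.
have [|x [y [/imsetP[i _ ->] /imsetP[j _ ->] nij nE le]]] := hG S.
  exists h; first by exists g.
  by move=> x y; rewrite -{2}(hK x) -{2}(hK y) /= /induced_edge /= fE.
exists i, j; split; rewrite -?fE //; last by rewrite /oedge le orbT.
by apply: contraNneq nij => ->.
Qed.


(** Contrapositive of heaviness for a listed copy of the graph. The edges in [s] are written in
    increasing order, so testing [(i, j)] for [i < j] settles both orientations. *)
Lemma heavy_seq n s (G : sgraph) (x0 : G) (vs : seq G) :
  graph_heavy (graph_of_edges n s) G -> size vs = n -> uniq vs ->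
  all (fun ij => ij.1 < ij.2) s ->
  (forall i j, i < j < n -> if (i, j) \in s then edge (nth x0 vs i) (nth x0 vs j)
                            else ~~ oedge (nth x0 vs i) (nth x0 vs j)) -> False.
Proof.
move=> hG sz un /allP lts H.
have swapN i j : i < j -> ((j, i) \in s) = false.
  by move=> ij; apply/negP => /lts /=; rewrite ltnNge ltnW.
have inj : injective (fun i : 'I_n => nth x0 vs i).
  by move=> i j /eqP; rewrite nth_uniq ?sz // => /eqP /val_inj.
have edgeE (i j : 'I_n) : i < j -> edge (nth x0 vs i) (nth x0 vs j) = ((val i, val j) \in s).
  move=> ij; have := H i j; rewrite ij ltn_ord => /(_ isT) /=.
  by case: ifP => // _; apply: contraNF => /edge_oedge.
have [i j|i [j [ij]]] := embedding_heavy hG inj.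
  rewrite /edges_rel; case: (ltngtP i j) => [lt|lt|/val_inj ->] /=.
  - by rewrite edgeE // -(inj_eq val_inj) neq_ltn lt /= (swapN _ _ lt) orbF.
  - by rewrite edge_sym edgeE // -(inj_eq val_inj) neq_ltn lt orbT /= (swapN _ _ lt).
  - by rewrite eqxx edge_irrefl.
have nlt (k l : 'I_n) : k < l -> ~~ edges_rel s k l -> ~~ oedge (nth x0 vs k) (nth x0 vs l).
  move=> kl; rewrite /edges_rel -(inj_eq val_inj) neq_ltn kl /= (swapN _ _ kl) orbF => nkl.
  by have := H k l; rewrite kl ltn_ord (negPf nkl) => /(_ isT).
case: (ltngtP i j) ij => [lt|lt|/val_inj ->]; last by rewrite eqxx.
  by move=> _ /(nlt _ _ lt) /negP.
by move=> _; rewrite edges_rel_sym oedge_sym => /(nlt _ _ lt) /negP.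
Qed.

Lemma edge_neq (G : sgraph) (u v : G) : edge u v -> u != v.
Proof. by apply: contraTneq => ->; rewrite edge_irrefl. Qed.

Lemma oedge_neq (G : sgraph) (u v w : G) : edge u w -> ~~ oedge v w -> u != v.
Proof. by move=> uw; apply: contraNneq => <-; apply: edge_oedge. Qed.

Ltac check_pairs :=
  let i := fresh in let j := fresh in intros i j; case/andP; revert j;
  case=> [|[|[|[|[|[|[|?]]]]]]]; try (by []); revert i; case=> [|[|[|[|[|[|[|?]]]]]]]; try (by []);
  move=> _ _; match goal with |- is_true (if ?b then _ else _) =>
    let b' := eval vm_compute in b in change b with b' end;
  assumption.

Lemma claw_oedge (G : sgraph) (c u v w : G) :
  graph_heavy claw G -> edge c u -> edge c v -> edge c w ->
  u != v -> u != w -> v != w -> [|| oedge u v, oedge u w | oedge v w].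
Proof.
move=> hG cu cv cw uv uw vw; apply/negPn/negP => /norP[nuv /norP[nuw nvw]].
apply: (heavy_seq (x0 := c) (vs := [:: c; u; v; w]) hG) => //=.
  by rewrite !inE !negb_or (edge_neq cu) (edge_neq cv) (edge_neq cw) uv uw vw.
check_pairs.
Qed.

Ltac neq_pair u v :=
  match goal with
  | H : is_true (edge u v) |- _ => exact: (edge_neq H)
  | H1 : is_true (edge u ?w), H2 : is_true (~~ oedge v ?w) |- _ => exact: (oedge_neq H1 H2)
  | H1 : is_true (edge ?w u), H2 : is_true (~~ oedge v ?w) |- _ =>
      by apply: (oedge_neq (w := w)); rewrite 1?edge_sym
  | H1 : is_true (edge u ?w), H2 : is_true (~~ oedge ?w v) |- _ =>
      by apply: (oedge_neq (w := w)); rewrite 1?oedge_sym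
  | H1 : is_true (edge ?w u), H2 : is_true (~~ oedge ?w v) |- _ =>
      by apply: (oedge_neq (w := w)); [rewrite edge_sym|rewrite oedge_sym]
  end.

Ltac uniq_vertices :=
  rewrite !inE !negb_or ?andbT; repeat (apply/andP; split);
  match goal with |- is_true (?u != ?v) =>
    first [neq_pair u v | rewrite eq_sym; neq_pair v u] end.

(* Nonadjacent vertices of [N112] and of [deer] have different neighbourhoods,
   so the seven vertices need not be assumed distinct. *)
Lemma N112_oedge (G : sgraph) (a b c a1 b1 c1 c2 : G) :
  graph_heavy N112 G ->
  edge a b -> edge b c -> edge a c -> edge a a1 -> edge b b1 -> edge c c1 -> edge c1 c2 ->
  ~~ oedge a b1 -> ~~ oedge a c1 -> ~~ oedge a c2 ->
  ~~ oedge b a1 -> ~~ oedge b c1 -> ~~ oedge b c2 ->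
  ~~ oedge c a1 -> ~~ oedge c b1 -> ~~ oedge c c2 ->
  ~~ oedge a1 b1 -> ~~ oedge a1 c1 -> ~~ oedge a1 c2 ->
  ~~ oedge b1 c1 -> ~~ oedge b1 c2 -> False.
Proof.
move=> hG; intros.
apply: (heavy_seq (x0 := a) (vs := [:: a; b; c; a1; b1; c1; c2]) hG) => //=.
  uniq_vertices.
check_pairs.
Qed.

Lemma deer_oedge (G : sgraph) (a b c a1 a2 b1 b2 : G) :
  graph_heavy deer G ->
  edge a b -> edge b c -> edge a c -> edge a a1 -> edge a1 a2 -> edge b b1 -> edge b1 b2 ->
  ~~ oedge a a2 -> ~~ oedge a b1 -> ~~ oedge a b2 ->
  ~~ oedge b a1 -> ~~ oedge b a2 -> ~~ oedge b b2 ->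
  ~~ oedge c a1 -> ~~ oedge c a2 -> ~~ oedge c b1 -> ~~ oedge c b2 ->
  ~~ oedge a1 b1 -> ~~ oedge a1 b2 -> ~~ oedge a2 b1 -> ~~ oedge a2 b2 -> False.
Proof.
move=> hG; intros.
apply: (heavy_seq (x0 := a) (vs := [:: a; b; c; a1; a2; b1; b2]) hG) => //=.
  uniq_vertices.
check_pairs.
Qed.

(** * Exchanging heavy pairs for edges *)

Lemma degree_count (G : sgraph) (P : seq G) (u : G) : uniq P ->
  degree u = count (edge u) P + #|[set w | edge u w & w \notin P]|.
Proof.
move=> un; rewrite /degree -(cardsID [set w in P]).
congr (_ + _); last by apply: eq_card => w; rewrite !inE andbC.
rewrite -size_filter -(card_uniqP (filter_uniq _ un)).
by apply: eq_card => w; rewrite !inE mem_filter andbC.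
Qed.

(** Shift the occurrences of [b] by one place. Either they meet an occurrence of [a], or they are
    disjoint from these and both fit into the places of [s]. *)
Lemma count_crossing (T : Type) (a b : pred T) (u : T) (s : seq T) :
  (exists s1 w s2, [/\ s = s1 ++ w :: s2, a w & b (last u s1)]) \/
  count a s + count b (belast u s) <= size s.
Proof.
elim: s u => [|v s IH] u; first by right.
have [/andP[av bu]|nab] := boolP (a v && b u); first by left; exists [::], v, s.
case: (IH v) => [[s1 [w [s2 [-> aw bw]]]]|le]; first by left; exists (v :: s1), w, s2.
by right; rewrite /=; move: nab le; case: (a v); case: (b u) => //=; lia.
Qed.

Section NonEdges.
Variable G : sgraph.
Implicit Types (u v w : G) (s t c : seq G).

(** The measure that the exchange argument decreases. *)
Fixpoint nonedges u s : nat :=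
  if s is v :: s' then ~~ edge u v + nonedges v s' else 0.

Lemma nonedges_cat u s t : nonedges u (s ++ t) = nonedges u s + nonedges (last u s) t.
Proof. by elim: s u => //= v s IH u; rewrite IH addnA. Qed.

Lemma nonedges_rev u s : nonedges (last u s) (rev (belast u s)) = nonedges u s.
Proof.
elim: s u => //= v s IH u.
rewrite rev_cons -cats1 nonedges_cat IH /= addn0 addnC; congr (nat_of_bool (~~ _) + _).
by case: s {IH} => [|w s] /=; rewrite ?rev_cons ?last_rcons edge_sym.
Qed.

Definition nonedges_cycle s : nat := if s is u :: s' then nonedges u (rcons s' u) else 0.

Lemma nonedges_cycle_cat s t : nonedges_cycle (s ++ t) = nonedges_cycle (t ++ s).
Proof.
case: s t => [|u s] [|v t] //=; rewrite ?cats0 //.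
rewrite !rcons_cat !nonedges_cat /= -!cats1 !nonedges_cat /=; lia.
Qed.

Lemma path_nonedges u s : path edge u s = (nonedges u s == 0).
Proof. by elim: s u => //= v s IH u; rewrite IH; case: (edge u v). Qed.

Lemma nonedges_split u s : 0 < nonedges u s ->
  exists s1 w s2, s = s1 ++ w :: s2 /\ ~~ edge (last u s1) w.
Proof.
elim: s u => //= v s IH u; have [uv|nuv] := boolP (edge u v); last by exists [::], v, s.
by rewrite add0n => /IH [s1 [w [s2 [-> nw]]]]; exists (v :: s1), w, s2.
Qed.

(* Either a common neighbour outside the cycle is inserted between the two ends of
   the path, or the degree sum forces a pair of crossing edges. *)
Lemma ore_step u s : path oedge u s -> uniq (u :: s) -> s != [::] ->
  ~~ edge (last u s) u -> oedge (last u s) u ->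
  exists c, [/\ uniq c, cycle oedge c, size s < size c & nonedges_cycle c < nonedges_cycle (u :: s)].
Proof.
set v := last u s => pus un s0 nvu; rewrite {1}/oedge (negPf nvu) orFb => heavy.
have nb0 : nonedges_cycle (u :: s) = nonedges u s + 1.
  by rewrite /= -cats1 nonedges_cat /= -/v nvu.
have [/existsP[w /and3P[uw vw wP]]|no_common] :=
    boolP [exists w, [&& edge u w, edge v w & w \notin u :: s]].
  exists (w :: u :: s); split => //.
  - by rewrite cons_uniq wP.
  - have [owu ovw] : oedge w u /\ oedge v w by split; apply: edge_oedge; rewrite // edge_sym.
    by rewrite /= owu rcons_path pus -/v ovw.
  - by rewrite nb0 /= -cats1 nonedges_cat /= -/v vw edge_sym uw /=; lia.
have [[s1 [w [s2 [Es uw vw]]]]|le] := count_crossing (edge u) (edge v) u s; last first.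
  (* With no crossing pair the neighbour counts of [u] and [v] on the path sum to at most [size s];
     with no common neighbour outside, those outside sum to at most [#|G| - (size s).+1]. The degree
     sum would be below [#|G|]. *)
  have := degree_count u un; have := degree_count v un.
  set Ov := [set _ | _ & _]; set Ou := [set _ | _ & _] => dv du.
  have: #|Ov| + #|Ou| <= #|~: [set x in u :: s]|.
    rewrite -cardsUI (_ : Ov :&: Ou = set0) ?cards0 ?addn0; last first.
      apply/setP=> x; rewrite !inE; apply/negP => /andP[/andP[vx xP] /andP[ux _]].
      by case/existsP: no_common; exists x; rewrite ux vx inE.
    by apply/subset_leq_card/subsetP => x; rewrite in_setC in_setU !in_set => /orP[] /andP[].
  have := cardsC [set x in u :: s].
  rewrite cardsE (card_uniqP un) /= => cC.
  have cu : count (edge u) (u :: s) = count (edge u) s by rewrite /= edge_irrefl.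
  have cv : count (edge v) (u :: s) = count (edge v) (belast u s).
    by rewrite lastI -cats1 count_cat /= -/v edge_irrefl !addn0.
  rewrite /= in cC; rewrite cu in du; rewrite cv in dv => leO; move: heavy; rewrite du dv -cC; lia.
have Ev : v = last w s2 by rewrite /v Es last_cat.
have El : last u (s1 ++ rev (w :: s2)) = w by rewrite last_cat rev_cons last_rcons.
have Er : rev (w :: s2) = v :: rev (belast w s2).
  by rewrite lastI rev_rcons -Ev.
have [pus1 _ pws2] : [/\ path oedge u s1, oedge (last u s1) w & path oedge w s2].
  by move: pus; rewrite Es cat_path /= => /and3P[].
(* The edges from [u] to [w] and from [v] to [last u s1] replace the pairs [(v, u)] and
   [(last u s1, w)], the first of which is no edge. *)
exists (u :: s1 ++ rev (w :: s2)); split.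
- by move: un; rewrite Es -!cat_cons !cat_uniq rev_uniq has_rev.
-rewrite /= rcons_path El cat_path pus1 Er /= [oedge _ v]edge_oedge ?[edge _ v]edge_sym //=.
  rewrite edge_oedge 1?edge_sym // andbT Ev rev_path.
  by rewrite (eq_path (e' := oedge)) // => x y; rewrite oedge_sym.
- by rewrite /= Es !size_cat size_rev.
- rewrite nb0 Es /= -cats1 -catA !nonedges_cat Er /= edge_sym vw /=.
  rewrite Ev nonedges_rev.
  have -> : last (last w s2) (rev (belast w s2)) = w.
    by case: s2 {Es Ev El Er pws2} => //= x s2; rewrite rev_cons last_rcons.
  rewrite [edge w u]edge_sym uw /=; lia.
Qed.

(** Rotate the cycle so that its closing pair is a non-edge, apply [ore_step], and repeat; the
    number of non-edges decreases. *)
Lemma ore_cycle c : uniq c -> cycle oedge c -> 1 < size c ->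
  exists c', [/\ uniq c', cycle edge c' & size c <= size c'].
Proof.
have [m] := ubnP (nonedges_cycle c); elim: m c => // m IH c lt un cyc sz.
case Ec: c => [|u s]; first by rewrite Ec in sz.
have [bad0|] := posnP (nonedges_cycle c).
  by exists c; split=> //; rewrite Ec // /cycle path_nonedges -/(nonedges_cycle (u :: s)) -Ec bad0.
rewrite Ec => /nonedges_split [s1 [w [s2 [Es nw]]]].
have Erot : exists t1 t2, c = t1 ++ t2 /\ t2 ++ t1 = w :: behead (t2 ++ t1) /\ last w (behead (t2 ++ t1)) = last u s1.
  (* If [s2] is empty, the non-edge is already the closing pair. *)
  case/lastP: s2 Es => [|s2 x] /eqP.
    rewrite cats1 eqseq_rcons => /andP[/eqP Es /eqP Eu].
    by exists [::], c; rewrite cats0 Ec Eu Es /=.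
  rewrite -rcons_cons -rcons_cat eqseq_rcons => /andP[/eqP Es _].
  by exists (u :: s1), (w :: s2); rewrite Ec Es /= last_cat.
case: Erot => t1 [t2 [Et [E1 E2]]]; set t := behead _ in E1 E2.
have Ert : w :: t = rot (size t1) c by rewrite Et rot_size_cat.
have cyc' : cycle oedge (w :: t) by rewrite Ert rot_cycle.
have un' : uniq (w :: t) by rewrite Ert rot_uniq.
have sz' : size (w :: t) = size c by rewrite Ert size_rot.
have Enb : nonedges_cycle (w :: t) = nonedges_cycle c by rewrite -E1 Et nonedges_cycle_cat.
have /andP[pwt lt_w] : path oedge w t && oedge (last w t) w by rewrite -rcons_path.
have [||c' [un2 cyc2 sz2 lt2]] := ore_step pwt un' _ _ lt_w.
- by move: sz; rewrite -sz'; case: (t).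
- by rewrite E2.
have [||c2 [? ? le2]] := IH c' _ un2 cyc2.
- by rewrite -ltnS; apply: leq_trans lt; rewrite ltnS -Enb.
- by apply: leq_ltn_trans sz2; move: sz; rewrite -sz' /=; lia.
exists c2; split => //; rewrite -Ec -sz' /=; exact: leq_trans sz2 le2.
Qed.

End NonEdges.

(** * Rerouting inside a segment *)

Lemma count_cons T (a : pred T) x s : count a (x :: s) = a x + count a s.
Proof. by []. Qed.

Lemma count_rcons T (a : pred T) s x : count a (rcons s x) = count a s + a x.
Proof. by rewrite -cats1 count_cat /= addn0. Qed.

(** Permuted lists are recognised by their counts for an arbitrary predicate, so rearranging
    segments becomes a linear identity. *)
Ltac perm_count :=
  apply/permP; let P := fresh in intro P;
  repeat match goal with H : is_true (perm_eq _ _) |- _ =>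
    generalize (elimT permP H P); clear H end;
  rewrite ?(count_cat, count_cons, count_rcons, count_rev); clear; simpl; intros; lia.

Section Coverings.
Variable G : sgraph.
Implicit Types (a b c d p q u v w x y : G) (s t X M : seq G).

(* [s] is the multiset of vertices of a path of o-edges from [a] to [b]. *)
Definition covers a b s : Prop :=
  exists t, [/\ path oedge a t, last a t = b & perm_eq (a :: t) s].

(** For a duplicate-free [s] the two paths partition it: a segment is traversed in two strokes. *)
Definition covers2 a b c d s : Prop :=
  exists s1 s2, [/\ covers a b s1, covers c d s2 & perm_eq (s1 ++ s2) s].

Lemma covers1 a : covers a a [:: a].
Proof. by exists [::]. Qed.

Lemma covers_path a s : path oedge a s -> covers a (last a s) (a :: s).
Proof. by exists s. Qed.

Lemma covers_perm a b s t : covers a b s -> perm_eq s t -> covers a b t.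
Proof. by case=> r [pr lr pe] /(perm_trans pe); exists r. Qed.

Lemma oedge_path_rev a s : path oedge (last a s) (rev (belast a s)) = path oedge a s.
Proof. by rewrite rev_path; apply: eq_path => u v; rewrite oedge_sym. Qed.

Lemma covers_sym a b s : covers a b s -> covers b a s.
Proof.
case=> r [pr lr pe]; exists (rev (belast a r)); split.
- by rewrite -lr oedge_path_rev.
- by case: r {pr pe} lr => [|c r] //= _; rewrite rev_cons last_rcons.
- by rewrite -lr -rev_rcons -lastI; apply: perm_trans pe; rewrite perm_rev.
Qed.

Lemma covers_cat a b c d s t :
  covers a b s -> oedge b c -> covers c d t -> covers a d (s ++ t).
Proof.
case=> r [pr lr pe] bc [r' [pr' lr' pe']]; exists (r ++ c :: r'); split.
- by rewrite cat_path /= lr pr bc.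
- by rewrite last_cat.
- by perm_count.
Qed.

Lemma covers_rcons a b c s : covers a b s -> oedge b c -> covers a c (s ++ [:: c]).
Proof. by move=> h bc; apply: covers_cat h bc (covers1 c). Qed.

(** [M] is the interior of the connecting path; when it is empty, the link is the single o-edge from
    [q] to [c]. *)
Lemma covers_link a q c b s t M :
  covers a q s -> path oedge q (rcons M c) -> covers c b t -> covers a b (s ++ M ++ t).
Proof.
case: M => [|m M] hs; first by rewrite /= andbT; apply: covers_cat.
rewrite /= rcons_path => /and3P[qm pM Mc] ht.
by apply: covers_cat hs qm (covers_cat (covers_path pM) Mc ht).
Qed.

Lemma path_rev_rcons q c M : path oedge q (rcons M c) -> path oedge c (rcons (rev M) q).
Proof. by rewrite -oedge_path_rev last_rcons belast_rcons rev_cons. Qed.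

Lemma covers_link_rev a q c b s t M :
  covers a c s -> path oedge q (rcons M c) -> covers q b t -> covers a b (s ++ M ++ t).
Proof.
move=> hs /path_rev_rcons pM ht; apply: covers_perm (covers_link hs pM ht) _.
by perm_count.
Qed.

Lemma covers_mem a b s : covers a b s -> (a \in s) && (b \in s).
Proof. by case=> r [_ <- /perm_mem pe]; rewrite -!pe mem_head mem_last. Qed.

(* A cycle running through the segment [X] from end [p] to end [q], with an extra
   path leaving [X] at [x], can be rerouted inside [X]. *)
Definition nice x p q X : Prop :=
  [/\ covers p q X, covers x p X, covers x q X &
  [/\ forall u, u \in X -> u != q -> covers2 x q p u X \/ covers2 x u p q X,
      forall u, u \in X -> u != p -> covers2 x p q u X \/ covers2 x u p q X &
      [/\ X = [:: x], p = x & q = x] \/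
      ((exists X1, perm_eq X (q :: X1) /\ covers x p X1) /\
       (exists X1, perm_eq X (p :: X1) /\ covers x q X1))]].

Lemma nice_perm x p q X Y : nice x p q X -> perm_eq X Y -> nice x p q Y.
Proof.
case=> n0 n1p n1q [n2 n3 n4] XY.
have c2 a b c d : covers2 a b c d X -> covers2 a b c d Y.
  by case=> s1 [s2 [? ? pe]]; exists s1, s2; split=> //; apply: perm_trans XY.
split; [exact: covers_perm n0 XY|exact: covers_perm n1p XY|exact: covers_perm n1q XY|].
split=> [u uY uq|u uY up|].
- by case: (n2 u); rewrite ?(perm_mem XY) // => /c2; auto.
- by case: (n3 u); rewrite ?(perm_mem XY) // => /c2; auto.
case: n4 => [[E -> ->]|[[X1 [? ?]] [X2 [? ?]]]].
  by left; split=> //; rewrite E in XY; apply/perm_small_eq; rewrite // perm_sym.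
by right; split; [exists X1|exists X2]; split=> //; perm_count.
Qed.

Lemma covers2_symr a b c d s : covers2 a b c d s -> covers2 a b d c s.
Proof. by case=> s1 [s2 [? /covers_sym ? ?]]; exists s1, s2. Qed.

Lemma nice_sym x p q X : nice x p q X -> nice x q p X.
Proof.
case=> n0 n1p n1q [n2 n3 n4]; split=> //; first exact: covers_sym.
split=> [u uX up|u uX uq|].
- by case: (n3 u uX up) => [|/covers2_symr] h; [left|right].
- by case: (n2 u uX uq) => [|/covers2_symr] h; [left|right].
- by case: n4 => [[? ? ?]|[? ?]]; [left|right].
Qed.

Lemma nice1 x : nice x x x [:: x].
Proof.
split; try exact: covers1.
by split=> [u|u|]; rewrite ?inE; [move/eqP->; rewrite eqxx|move/eqP->; rewrite eqxx|left].
Qed.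

Lemma covers2_rcons_l a b c d e s : covers2 a b c d s -> oedge b e ->
  covers2 a e c d (s ++ [:: e]).
Proof.
case=> s1 [s2 [h1 h2 pe]] be; exists (s1 ++ [:: e]), s2; split=> //.
  by eapply covers_rcons; eassumption.
by perm_count.
Qed.

Lemma covers2_rcons_r a b c d e s : covers2 a b c d s -> oedge d e ->
  covers2 a b c e (s ++ [:: e]).
Proof.
case=> s1 [s2 [h1 h2 pe]] be; exists s1, (s2 ++ [:: e]); split=> //.
  by eapply covers_rcons; eassumption.
by perm_count.
Qed.

(** The path from [x] to [p] uses the splitting clause for [u]: its two paths have the ends [x],
    [p], [q], [u] and are joined through [a], which is o-adjacent to [q] and [u]. *)
Lemma nice_extend x p q a u X : nice x p q X -> oedge q a -> u \in X -> u != q ->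
  oedge a u -> nice x p a (X ++ [:: a]).
Proof.
case=> n0 n1p n1q [n2 n3 n4] qa uX uq au.
split; try by eapply covers_rcons; eassumption.
  case: (n2 u uX uq) => -[s1 [s2 [h1 h2 pe]]].
    apply: covers_perm (covers_cat (covers_rcons h1 qa) au (covers_sym h2)) _.
    by perm_count.
  rewrite oedge_sym in qa; rewrite oedge_sym in au.
  apply: covers_perm (covers_cat (covers_rcons h1 au) qa (covers_sym h2)) _.
  by perm_count.
split=> [v|v|].
- rewrite mem_cat inE => /orP[vX _|->] //; have [->|vq] := eqVneq v q.
    case: (n2 u uX uq) => -[s1 [s2 [h1 h2 pe]]].
      right; exists s1, (s2 ++ [:: a]); rewrite oedge_sym in au.
      by split=> //; [eapply covers_rcons; eassumption|perm_count].
    left; exists (s1 ++ [:: a]), s2; rewrite oedge_sym in au.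
    by split=> //; [eapply covers_rcons; eassumption|perm_count].
  by case: (n2 v vX vq) => h; [left; exact: covers2_rcons_l h qa|right; exact: covers2_rcons_r h qa].
- rewrite mem_cat inE => /orP[vX vp|/eqP-> _].
    case: (n3 v vX vp) => h; last by right; exact: covers2_rcons_r h qa.
    by left; apply: covers2_symr; exact: covers2_rcons_r (covers2_symr h) qa.
  by left; exists X, [:: a]; split=> //; apply: covers1.
- right; split; first by exists X; split=> //; perm_count.
  case: n4 => [[EX _ Eq]|[_ [X1 [pe h]]]].
    by move: uX uq; rewrite EX Eq inE => ->.
  by exists (X1 ++ [:: a]); split; [perm_count|eapply covers_rcons; eassumption].
Qed.

(** The o-edge between [a] and [b] lets a path that leaves [X] at [q] end in [b], and one that
    leaves it at [p] end in [a]. *)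
Lemma nice_extend2 x p q a b X : nice x p q X -> oedge q a -> oedge p b -> oedge a b ->
  nice x b a (b :: X ++ [:: a]).
Proof.
case=> n0 n1p n1q [n2 n3 n4] qa pb ab.
have ba : oedge b a by rewrite oedge_sym.
have bp : oedge b p by rewrite oedge_sym.
have pab : covers b a [:: b; a] by apply: (covers_path (s := [:: a])); rewrite /= ba.
split.
- exact: (covers_cat (covers1 b) bp (covers_rcons n0 qa)).
- by apply: covers_perm (covers_rcons (covers_rcons n1q qa) ab) _; perm_count.
- by apply: covers_perm (covers_rcons (covers_rcons n1p pb) ba) _; perm_count.
split=> [v|v|].
- rewrite inE mem_cat inE => /or3P[/eqP-> _|vX _|->//].
    left; exists (X ++ [:: a]), [:: b].
    by split; [exact: covers_rcons n1q qa|apply: covers1|perm_count].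
  have [->|vq] := eqVneq v q; first by right; exists X, [:: b; a]; split=> //; perm_count.
  case: (n2 v vX vq) => -[s1 [s2 [h1 h2 pe]]].
    left; exists (s1 ++ [:: a]), (b :: s2).
    by split; [exact: covers_rcons h1 qa|exact: covers_cat (covers1 b) bp h2|perm_count].
  right; exists s1, (b :: s2 ++ [:: a]).
  by split=> //; [apply: (covers_cat (covers1 b) bp (covers_rcons h2 qa))|perm_count].
- rewrite inE mem_cat inE => /or3P[->//|vX _|/eqP-> _]; last first.
    left; exists (X ++ [:: b]), [:: a].
    by split; [exact: covers_rcons n1p pb|apply: covers1|perm_count].
  have [->|vp] := eqVneq v p; first by right; exists X, [:: b; a]; split=> //; perm_count.
  rewrite oedge_sym in qa; case: (n3 v vX vp) => -[s1 [s2 [h1 h2 pe]]].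
    left; exists (s1 ++ [:: b]), (a :: s2).
    by split; [exact: covers_rcons h1 pb|exact: covers_cat (covers1 a) qa h2|perm_count].
  rewrite oedge_sym in qa.
  right; exists s1, (b :: s2 ++ [:: a]).
  by split=> //; [apply: (covers_cat (covers1 b) bp (covers_rcons h2 qa))|perm_count].
- right; split; [exists (X ++ [:: b])|exists (X ++ [:: a])];
  by split; [perm_count|first [exact: covers_rcons n1p pb|exact: covers_rcons n1q qa]].
Qed.

(* A heavy pair [q], [u] such that the cycle can be rerouted in [X] so as to use any
   o-edge leaving [X] at [q] or at [u]. *)
Definition good x p q X : Prop :=
  exists X1 u, [/\ perm_eq X (q :: X1), covers x p X1, #|G| <= degree q + degree u &
    covers2 x q p u X \/ covers2 x u p q X].

Lemma nice_good x p q u X : nice x p q X -> u \in X -> u != q ->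
  #|G| <= degree q + degree u -> good x p q X.
Proof.
case=> _ _ _ [n2 _ n4] uX uq hqu.
case: n4 => [[EX _ Eq]|[[X1 [pe h]] _]]; first by move: uX uq; rewrite EX Eq inE => ->.
by exists X1, u; split=> //; apply: n2.
Qed.

End Coverings.

Ltac arith :=
  repeat match goal with H : ?T |- _ =>
    lazymatch T with
    | is_true (_ <= _) => fail
    | is_true (_ <= _ < _) => fail
    | is_true (_ < _ <= _) => fail
    | is_true (_ || _) => fail
    | _ = _ :> nat => fail
    | nat => fail
    | _ => clear H
    end end; lia.

(** * Three pendant vertices *)

Section ShortestPaths.
Variable G : sgraph.
Implicit Types (u v w : G) (s : seq G) (V T : pred G).

Lemma shortest_path V T u :
  (exists s, [/\ path edge u s, all V s & T (last u s)]) ->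
  exists s, [/\ path edge u s, all V s, T (last u s) &
    forall s', path edge u s' -> all V s' -> T (last u s') -> size s <= size s'].
Proof.
move=> [s0 [ps0 Vs0 Ts0]].
pose P n := [exists t : n.-tuple G, [&& path edge u t, all V t & T (last u t)]].
have exP : exists n, P n.
  by exists (size s0); apply/existsP; exists (in_tuple s0); apply/and3P.
case: (ex_minnP exP) => n /existsP[t /and3P[pt Vt Tt]] min.
exists t; split=> // s' ps' Vs' Ts'; rewrite size_tuple; apply: min.
by apply/existsP; exists (in_tuple s'); apply/and3P.
Qed.

(** Omitting the stretch between two equal vertices, or replacing it by a chord, would give a
    shorter path inside [V]. *)
Lemma shortest_path_induced V v u s :
  path edge u s -> all V s -> last u s = v ->
  (forall s', path edge u s' -> all V s' -> last u s' = v -> size s <= size s') ->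
  forall i j, i < j <= size s ->
    nth u (u :: s) i != nth u (u :: s) j /\
    (edge (nth u (u :: s) i) (nth u (u :: s) j) -> j = i.+1).
Proof.
move=> ps Vs ls min i [//|j] /andP[ij js].
have lti : last u (take i s) = nth u (u :: s) i.
  rewrite (last_nth u) size_takel; last by arith.
  by case: (i) => //= k; rewrite nth_take.
have dropE : drop j s = nth u s j :: drop j.+1 s by rewrite -drop_nth.
have Edec : path edge u (take i s) /\ path edge (nth u s j) (drop j.+1 s).
  split; first exact: take_path.
  by move: ps; rewrite -{1}(cat_take_drop j s) cat_path dropE /= => /and3P[].
case: Edec => p1 p2.
have [V1 V2] : all V (take i s) /\ all V (drop j s).
  by split; apply/allP => x; [move/mem_take|move/mem_drop]; apply: (allP Vs).
have lj : last (nth u s j) (drop j.+1 s) = v.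
  by rewrite -ls -[in RHS](cat_take_drop j s) last_cat dropE.
split.
  apply/eqP => Eij.
  have := min (take i s ++ drop j.+1 s); rewrite cat_path p1 lti Eij p2 last_cat lti Eij lj.
  rewrite all_cat V1 size_cat size_takel ?size_drop; last by arith.
  have -> : all V (drop j.+1 s) by move: V2; rewrite dropE => /andP[].
  by move=> /(_ isT isT erefl); arith.
move=> eij.
have := min (take i s ++ drop j s); rewrite cat_path p1 lti dropE /= p2 last_cat /= lj.
rewrite -dropE all_cat V1 V2 size_cat size_takel ?size_drop; last by arith.
by rewrite eij => /(_ isT isT erefl); arith.
Qed.

(* A shortest path L from u1 to u2, then a shortest path from u3 to L: the last
   vertex outside L sees exactly two consecutive vertices of L, because of the
   claws, which is a triangle with three tails. *)
Lemma three_pendants (X : pred G) (u1 u2 u3 v1 v2 v3 : G) :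
  graph_heavy claw G -> graph_heavy N112 G ->
  uniq [:: u1; u2; u3] -> ~~ X u1 -> ~~ X u2 -> ~~ X u3 -> X v1 -> X v2 -> X v3 ->
  edge u1 v1 -> edge u2 v2 -> edge u3 v3 ->
  let V w := [|| w == u1, w == u2, w == u3 | X w] in
  (forall w, V w -> edge u1 w -> w = v1) ->
  (forall w, V w -> edge u2 w -> w = v2) ->
  (forall w, V w -> edge u3 w -> w = v3) ->
  (forall s t : G, V s -> V t -> s != t -> oedge s t -> edge s t) ->
  (forall s t : G, X s -> X t -> exists r, [/\ path edge s r, all X r & last s r = t]) ->
  [/\ edge v1 v2, edge v1 v3 & edge v2 v3].
Proof.
move=> hclaw hN un X1 X2 X3 Xv1 Xv2 Xv3 e1 e2 e3 V N1 N2 N3 light conn.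
have [n12 n13 n23] : [/\ u1 != u2, u1 != u3 & u2 != u3].
  by move: un; rewrite /= !inE negb_or andbT => /andP[/andP[]].
have nadj (s t : G) : V s -> V t -> s != t -> ~~ edge s t -> ~~ oedge s t.
  by move=> Vs Vt st; apply: contra; apply: light.
have XV w : X w -> V w by move=> Xw; rewrite /V Xw !orbT.
have Vu3 : V u3 by rewrite /V eqxx !orbT.
pose V1 w := [|| w == u1, w == u2 | X w].
have V1V w : V1 w -> V w by rewrite /V1 /V => /or3P[] ->; rewrite ?orbT.
have [|s [ps Vs /eqP ls min]] := @shortest_path V1 (pred1 u2) u1.
  have [r [pr Xr lr]] := conn _ _ Xv1 Xv2; exists (v1 :: rcons r u2).
  rewrite /= rcons_path last_rcons lr e1 pr edge_sym e2 eqxx; split=> //.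
  rewrite all_rcons /= {1 2}/V1 Xv1 !eqxx !orbT /=.
  by apply: sub_all Xr => w Xw; rewrite /V1 Xw !orbT.
have ind := @shortest_path_induced V1 u2 u1 s ps Vs ls (fun s' p a l => min s' p a (introT eqP l)).
set L := u1 :: s in ind.
have VL w : w \in L -> V1 w.
  by rewrite inE => /orP[/eqP->|/(allP Vs)//]; rewrite /V1 /= eqxx.
have L3 w : w \in L -> w != u3.
  by move/VL; apply: contraTneq => ->; rewrite /V1 !negb_or X3 ![u3 == _]eq_sym n13 n23.
pose l i := nth u1 L i.
(* [L] is not a single edge: the only neighbour of [u1] in [V] is [v1], which lies in [X], whereas
   [u2] does not. *)
have sz : 1 < size s.
  case: s ps ls Vs {ind L VL L3 l min} => [|a [|b s]] //=; first by move=> _ E; rewrite E eqxx in n12.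
  rewrite andbT => ua E _; have := N1 a; rewrite E in ua *.
  by rewrite /V eqxx orbT => /(_ isT ua) E2; rewrite E2 Xv1 in X2.
have memL i : i <= size s -> l i \in L by move=> le; apply: mem_nth.
have l0 : l 0 = u1 by [].
have lk : l (size s) = u2 by rewrite /l nth_last.
have step i : i < size s -> edge (l i) (l i.+1) by move=> lt; apply: (pathP u1 ps).
have l1 : l 1 = v1.
  apply: N1; last by rewrite -l0 step // ltnW.
  by apply/V1V/VL/memL; rewrite ltnW.
have lk1 : l (size s).-1 = v2.
  apply: N2; first exact/V1V/VL/memL/leq_pred.
  have lt : (size s).-1 < size s by rewrite prednK // ltnW.
  by rewrite -lk edge_sym; have := step _ lt; rewrite prednK // ltnW.
have nLL i j : i.+1 < j <= size s -> ~~ oedge (l i) (l j).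
  move=> /andP[ij js]; have [|ne ei] := ind i j; first by rewrite ltnW.
  apply: nadj => //; try by apply/V1V/VL/memL; arith.
  by apply/negP => /ei E; move: ij; rewrite E ltnn.
have neLL i j : i < j <= size s -> l i != l j by move=> h; have [] := ind i j h.
have [|r [pr Vr Lr minr]] := @shortest_path V (mem L) u3.
  have [r [pr Xr lr]] := conn _ _ Xv3 Xv1; exists (v3 :: r).
  rewrite /= e3 pr XV //= lr -l1; split=> //; first by apply: sub_all Xr.
  by apply: memL; rewrite ltnW.
(* By minimality only the last vertex of [u3 :: r] lies on [L], and only the last two can have
   o-neighbours on [L]. *)
have far r1 r2 : r = r1 ++ r2 -> 0 < size r2 -> last u3 r1 \notin L /\ V (last u3 r1).
  move=> Er r2_gt0; move: pr Vr; rewrite Er cat_path all_cat => /andP[p1 _] /andP[a1 _].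
  split; last by case/lastP: r1 a1 {Er p1} => // r1 x; rewrite all_rcons last_rcons => /andP[].
  by apply/negP => h; have := minr r1 p1 a1 h; rewrite Er size_cat; arith.
have far2 r1 r2 i : r = r1 ++ r2 -> 1 < size r2 -> i <= size s -> ~~ oedge (last u3 r1) (l i).
  move=> Er r2_gt1 le; have [nL Vl] := far _ _ Er (ltnW r2_gt1).
  move: pr Vr; rewrite Er cat_path all_cat => /andP[p1 _] /andP[a1 _].
  apply: nadj => //; first exact/V1V/VL/memL.
    by apply: contraNneq nL => ->; apply: memL.
  apply/negP => h; have := minr (rcons r1 (l i)).
  rewrite rcons_path p1 h all_rcons a1 last_rcons V1V ?VL ?memL // size_rcons Er size_cat.
  by move=> /(_ isT isT (memL i le)); arith.
case/lastP: r => [|r0 y] in pr Vr Lr minr far far2 *.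
  by move: (L3 _ Lr); rewrite eqxx.
rewrite last_rcons in Lr.
have Er0 : rcons r0 y = r0 ++ [:: y] by rewrite cats1.
pose w := last u3 r0; have [wL Vw] := far _ _ Er0 isT; rewrite -/w in wL Vw.
have ewy : edge w y by move: pr; rewrite rcons_path => /andP[].
have newL i : i <= size s -> w != l i by move=> le; apply: contraNneq wL => ->; apply: memL.
have nw1 : ~~ edge w (l 0).
  apply: contraNN wL => h; rewrite (N1 w Vw) -?l1 ?memL 1?ltnW //.
  by rewrite edge_sym -l0.
have nwk : ~~ edge w (l (size s)).
  apply: contraNN wL => h; rewrite (N2 w Vw) -?lk1 ?memL //; first by arith.
  by rewrite edge_sym -lk.
(* [i] and [j] will be the first and the last place of a neighbour of [w] on [L]. *)
pose P i := (i <= size s) && edge w (l i).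
have exP : exists i, P i.
  by exists (index y L); rewrite /P /l nth_index // ewy andbT -ltnS index_mem.
have leP i : P i -> i <= size s by case/andP.
case: (ex_minnP exP) => i /andP[ile wi] imin.
case: (ex_maxnP exP leP) => j /andP[jle wj] jmax.
have ij : i <= j by apply: imin; rewrite /P jle.
have i_gt0 : 0 < i by rewrite lt0n; apply: contraNneq nw1 => <-.
have j_lt : j < size s by rewrite ltn_neqAle jle andbT; apply: contraNneq nwk => <-.
have nwl k : k <= size s -> (k < i) || (j < k) -> ~~ oedge w (l k).
  move=> kle out; apply: nadj => //; [exact/V1V/VL/memL|exact: newL|].
  apply/negP => wk; have Pk : P k by rewrite /P kle.
  by move: out; rewrite !ltnNge imin // jmax.
have back k : 0 < k <= size s -> edge (l k) (l k.-1).
  by case: k => // k /= lt; rewrite edge_sym step.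
(* A single neighbour [l i] would be the centre of a claw with leaves [l i.-1], [l i.+1] and [w]. *)
have [E|ltij] := eqVneq i j.
  subst j; have i1 : i.-1 < i by rewrite prednK.
  have o1 : ~~ oedge (l i.-1) (l i.+1) by apply: nLL; arith.
  have o2 : ~~ oedge (l i.-1) w by rewrite oedge_sym; apply: nwl; arith.
  have o3 : ~~ oedge (l i.+1) w by rewrite oedge_sym; apply: nwl; arith.
  have ew : edge (l i) w by rewrite edge_sym.
  have back_i : edge (l i) (l i.-1) by apply: back; arith.
  have ne1 : l i.-1 != l i.+1 by apply: neLL; arith.
  have ne2 : l i.-1 != w by rewrite eq_sym newL //; arith.
  have ne3 : l i.+1 != w by rewrite eq_sym newL.
  have := claw_oedge hclaw back_i (step i j_lt) ew ne1 ne2 ne3.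
  by rewrite (negPf o1) (negPf o2) (negPf o3).
have {}ltij : i < j by rewrite ltn_neqAle ltij.
(* If [r0] is empty, [w] is [u3], which has only the neighbour [v3] in [V], against [i < j]. *)
case/lastP: r0 => [|r1 x] in pr Vr minr far far2 Er0 w wL Vw ewy newL nw1 nwk P exP leP wi imin wj jmax nwl *.
  have {}wi : l i = v3 by apply: N3 => //; exact/V1V/VL/memL.
  have {}wj : l j = v3 by apply: N3 => //; exact/V1V/VL/memL.
  by have := neLL i j; rewrite wi wj eqxx; arith.
pose x' := last u3 r1.
have Ew : w = x by rewrite /w last_rcons.
have Er1 : rcons (rcons r1 x) y = r1 ++ [:: x; y] by rewrite -!cats1 -catA.
have [x'L Vx'] := far _ _ Er1 isT; rewrite -/x' in x'L Vx'.
have nx' k : k <= size s -> ~~ oedge x' (l k) by apply: far2 Er1 isT.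
have ex'w : edge w x'.
  by rewrite edge_sym Ew; move: pr; rewrite !rcons_path => /andP[/andP[]].
(* Neighbours [l i] and [l j] that are not consecutive on [L] form a claw at [w] with the preceding
   vertex [x']. *)
have [ltij2|] := ltnP i.+1 j.
  have := @claw_oedge G w x' (l i) (l j) hclaw ex'w wi wj.
  rewrite (negPf (nx' _ _)) // (negPf (nx' _ _)) // (negPf (nLL _ _ _)) ?ltij2 //=.
  move=> h; case: (notF (h _ _ _)); last by apply: neLL; arith.
    by apply: contraNneq x'L => ->; apply: memL.
  by apply: contraNneq x'L => ->; apply: memL.
move=> ji; have Ej : j = i.+1 by arith.
subst j.
have osym a b : ~~ oedge a b -> ~~ oedge b a by rewrite oedge_sym.
have esym a b : edge a b -> edge b a by rewrite edge_sym.
have nwl' k : k <= size s -> (k < i) || (i.+1 < k) -> ~~ oedge (l k) w.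
  by move=> *; apply/osym/nwl.
have nx'' k : k <= size s -> ~~ oedge (l k) x' by move=> *; apply/osym/nx'.
have nLL' a b : b.+1 < a <= size s -> ~~ oedge (l a) (l b) by move=> *; apply/osym/nLL.
(* If [x'] is [u3], the tail of length 2 must be found along [L]. When neither side is long enough,
   [L] is [u1 v1 v2 u2] and [w] is [v3], so the triangle is the one claimed. *)
case/lastP: r1 => [|r2 z] in pr Vr minr far far2 Er0 w wL Vw ewy newL nw1 nwk P exP leP
    wi imin wj jmax nwl nwl' x' Ew Er1 x'L Vx' nx' nx'' ex'w *.
  have Ewv : w = v3 by apply: N3; rewrite // edge_sym.
  have [i_gt1|] := ltnP 1 i.
    case: (@N112_oedge G (l i.+1) w (l i) (l i.+2) u3 (l i.-1) (l i.-2) hN) => //;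
      try exact: esym; try exact: step; try exact: nx'; try exact: nx''; try (apply: nLL; arith);
      try (apply: nLL'; arith); try (apply: back; arith); try (apply: nwl; arith); try (apply: nwl'; arith);
      try (apply: nx'; arith); try (apply: nx''; arith).
  move=> i_le1; have Ei : i = 1 by arith.
  have [j_lt2|] := ltnP i.+2 (size s).
    case: (@N112_oedge G (l i) w (l i.+1) (l i.-1) u3 (l i.+2) (l i.+3) hN) => //;
      try exact: esym; try exact: step; try exact: nx'; try exact: nx''; try (apply: nLL; arith);
      try (apply: nLL'; arith); try (apply: back; arith); try (apply: nwl; arith); try (apply: nwl'; arith);
      try (apply: nx'; arith); try (apply: nx''; arith).
  move=> j_ge; have Ek : i.+1 = (size s).-1 by arith.
  rewrite -lk1 -Ek -l1 -{1 2}Ei -Ewv; split; [exact: step|exact: esym|exact: esym].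
(* Now the tail of length 2 is at [w], namely [x' z']. *)
pose z' := last u3 r2.
have Er2 : rcons (rcons (rcons r2 z) x) y = r2 ++ [:: z; x; y] by rewrite -!cats1 -!catA.
have Ex' : x' = z by rewrite /x' last_rcons.
have [z'L Vz'] := far _ _ Er2 isT; rewrite -/z' in z'L Vz'.
have nz' k : k <= size s -> ~~ oedge z' (l k) by apply: far2 Er2 isT.
have nz'' k : k <= size s -> ~~ oedge (l k) z' by move=> *; apply/osym/nz'.
have ezx : edge x' z'.
  by rewrite edge_sym Ex'; move: pr; rewrite !rcons_path => /andP[/andP[/andP[]]].
have [p2 a2] : path edge u3 r2 /\ all V r2.
  by move: pr Vr; rewrite Er2 cat_path all_cat => /andP[? _] /andP[? _].
have nwz : ~~ oedge w z'.
  apply/osym; apply: nadj => //.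
    apply/negP => /eqP E; have := minr (rcons r2 y).
    rewrite rcons_path p2 last_rcons all_rcons a2 -/z' E ewy !size_rcons.
    by rewrite V1V ?VL //; move=> /(_ isT isT Lr); arith.
  apply/negP => h; have := minr (rcons (rcons r2 w) y).
  rewrite !rcons_path p2 !last_rcons !all_rcons a2 Vw -/z' h ewy !size_rcons.
  by rewrite V1V ?VL //; move=> /(_ isT isT Lr); arith.
case: (@N112_oedge G (l i) (l i.+1) w (l i.-1) (l i.+2) x' z' hN) => //;
  try exact: esym; try exact: step; try exact: nx'; try exact: nx''; try (apply: nLL; arith);
  try (apply: nLL'; arith); try (apply: back; arith); try (apply: nwl; arith); try (apply: nwl'; arith);
  try (apply: nx'; arith); try (apply: nx''; arith); try (apply: nz'; arith); try (apply: nz''; arith).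
Qed.

End ShortestPaths.

(** * A longest cycle and a path outside it *)

Section Theta.
Variables (G : sgraph) (N : nat).
Implicit Types (a b c d p q r u v w x y z : G) (s t S X Y A B M R : seq G).

Hypothesis max_cycle :
  forall C : seq G, uniq C -> cycle oedge C -> 1 < size C -> size C <= N.

(** A theta graph: [x A y B] is a cycle of length [N], with [A] read from [x] to [y] and [B] from
    [y] back to [x], and [R] is the interior of a path from [x] to [y] off the cycle. *)
Definition theta x A y B R : Prop :=
  [/\ path edge x (rcons A y), path edge y (rcons B x), path edge x (rcons R y) &
  [/\ uniq (x :: A ++ y :: B ++ R), (size A + size B).+2 = N & R != [::]]].

Lemma edge_path a s : path edge a s -> path oedge a s.
Proof. by apply: sub_path => u v; apply: edge_oedge. Qed.

Lemma edge_path_rev a M b : path edge a (rcons M b) -> path edge b (rcons (rev M) a).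
Proof.
have := rev_path edge a (rcons M b); rewrite last_rcons belast_rcons rev_cons => ->.
by apply: sub_path => u v; rewrite edge_sym.
Qed.

Lemma theta_swap x A y B R : theta x A y B R -> theta y B x A (rev R).
Proof.
case=> pA pB pR [un sz R0]; split=> //; first exact: edge_path_rev.
split; last by rewrite -size_eq0 size_rev size_eq0.
- suff /perm_uniq -> : perm_eq (y :: B ++ x :: A ++ rev R) (x :: A ++ y :: B ++ R) by [].
  by perm_count.
- by rewrite addnC.
Qed.

Lemma covers_close a b S M : covers a b S -> path oedge a (rcons M b) -> uniq (S ++ M) ->
  1 < size (S ++ M) -> size (S ++ M) <= N.
Proof.
move=> hS pM un sz.
have [t [pt lt pe]] : exists t, [/\ path oedge a t, oedge (last a t) a & perm_eq (a :: t) (S ++ M)].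
  case: M => [|m M] in pM un sz *.
    case: hS => t [pt lt pe]; exists t; rewrite lt cats0; split=> //.
    by rewrite oedge_sym; case/andP: pM.
  have /covers_sym hM := covers_path pM.
  move: pM; rewrite rcons_cons /= rcons_path => /and3P[am pM mb].
  have hM' := covers_sym (covers_path pM); rewrite oedge_sym in mb.
  have [t [pt lt pe]] := covers_cat hS mb hM'.
  by exists t; rewrite lt oedge_sym; split.
rewrite -(perm_size pe); apply: max_cycle.
- by rewrite (perm_uniq pe).
- by rewrite /= rcons_path pt.
- by rewrite (perm_size pe).
Qed.

(** Closing the path through [R] would give a cycle with more than [N] vertices. *)
Lemma theta_close x A y B R S : theta x A y B R -> covers x y S ->
  perm_eq S (x :: A ++ y :: B) -> False.
Proof.
case=> _ _ /edge_path pR [un sz R0] hS pe.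
have pe' : perm_eq (S ++ R) (x :: A ++ y :: B ++ R) by perm_count.
have := covers_close hS pR; rewrite (perm_uniq pe') un (perm_size pe') /= !size_cat /= size_cat.
have : 0 < size R by rewrite lt0n size_eq0.
by move=> R1 /(_ isT); lia.
Qed.

(** The path is closed from [r] back to [x] along the initial part of [R]; the cycle gains at least
    the vertex [r]. *)
Lemma theta_close_at x A y B R S r u : theta x A y B R -> r \in R -> covers x u S ->
  oedge u r -> perm_eq S (x :: A ++ y :: B) -> False.
Proof.
case=> _ _ pR [un sz R0] rR hS ur pe.
case/splitPr: rR pR un R0 => R1 R2 pR un _.
have pR1 : path oedge x (rcons R1 r).
  by apply: edge_path; move: pR; rewrite rcons_cat -cat_rcons cat_path => /andP[].
have := covers_close (covers_rcons hS ur) pR1.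
have pe' : perm_eq (((S ++ [:: r]) ++ R1) ++ R2) (x :: A ++ y :: B ++ R1 ++ r :: R2).
  by perm_count.
move: un; rewrite -(perm_uniq pe') cat_uniq => /andP[-> _] /(_ isT).
have pe2 : perm_eq ((S ++ [:: r]) ++ R1) (x :: A ++ y :: B ++ R1 ++ [:: r]) by perm_count.
by rewrite (perm_size pe2) /= !size_cat /= !size_cat /=; lia.
Qed.

(** The four degrees add up to at least twice the order. *)
Lemma heavy_pairs a b c d : #|G| <= degree a + degree b -> #|G| <= degree c + degree d ->
  oedge a c \/ oedge b d.
Proof.
move=> ab cd; rewrite /oedge.
have [h|h] := boolP (#|G| <= degree a + degree c); first by left; rewrite orbT.
suff h' : #|G| <= degree b + degree d by right; rewrite h' orbT.
by move: h; rewrite -ltnNge; lia.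
Qed.

(** * Enlarged segments around the two ends of the outside path *)

Section Ends.
Variables (x y : G) (A B R : seq G).
Hypothesis th : theta x A y B R.

(** The cycle runs through [p], [q], [c], [d] in this order. The ends [q] and [d] cannot be
    o-adjacent, so their partners [u] and [v] are. If both segments split in the second way, [q] is
    matched with [v] and [u] with [d] instead. *)
Lemma good_same p q c d X Y M1 M2 : perm_eq (X ++ M1 ++ Y ++ M2) (x :: A ++ y :: B) ->
  path oedge q (rcons M1 c) -> path oedge d (rcons M2 p) ->
  good x p q X -> good y c d Y -> False.
Proof.
move=> pe l1 l2 [X1 [u [peX hX1 hqu hX]]] [Y1 [v [peY hY1 hdv hY]]].
have qd : ~~ oedge q d.
  apply/negP => qd; rewrite oedge_sym in qd.
  apply: (theta_close th (covers_link_rev hX1 l2 (covers_cat (covers1 d) qd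
           (covers_link (covers1 q) l1 (covers_sym hY1))))); perm_count.
have uv : oedge u v by case: (heavy_pairs hqu hdv) => // h; rewrite h in qd.
have vu := uv; rewrite oedge_sym in vu.
case: hX => -[s1 [s2 [hs1 hs2 pes]]]; case: hY => -[t1 [t2 [ht1 ht2 pet]]].
- apply: (theta_close th (covers_link hs1 l1 (covers_cat ht2 vu
    (covers_link_rev (covers_sym hs2) l2 (covers_sym ht1))))); perm_count.
- apply: (theta_close th (covers_link hs1 l1 (covers_link ht2 l2
    (covers_cat hs2 uv (covers_sym ht1))))); perm_count.
- apply: (theta_close th (covers_cat hs1 uv (covers_link_rev (covers_sym ht2) l1
    (covers_link_rev (covers_sym hs2) l2 (covers_sym ht1))))); perm_count.
rewrite addnC in hdv; case: (heavy_pairs hqu hdv) => [qv|ud].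
- apply: (theta_close th (covers_link_rev hX1 l2 (covers_link_rev (covers_sym ht2) l1
    (covers_cat (covers1 q) qv (covers_sym ht1))))); perm_count.
- rewrite oedge_sym in ud.
  apply: (theta_close th (covers_sym (covers_link_rev hY1 l1 (covers_link_rev (covers_sym hs2) l2
    (covers_cat (covers1 d) ud (covers_sym hs1)))))); perm_count.
Qed.

(** The heavy pairs contain the ends [q] and [c] of [M1]; one of the pairs [q], [v] and [u], [c] is
    an o-edge, and either closes a longer cycle. *)
Lemma good_opposite p q c d X Y M1 M2 : perm_eq (X ++ M1 ++ Y ++ M2) (x :: A ++ y :: B) ->
  path oedge q (rcons M1 c) -> path oedge d (rcons M2 p) ->
  good x p q X -> good y d c Y -> False.
Proof.
move=> pe l1 l2 [X1 [u [peX hX1 hqu hX]]] [Y1 [v [peY hY1 hcv hY]]].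
rewrite addnC in hcv; case: (heavy_pairs hqu hcv) => [qv|uc].
  have vq := qv; rewrite oedge_sym in vq.
  case: hY => -[t1 [t2 [ht1 ht2 pet]]].
  - apply: (theta_close th (covers_link_rev hX1 l2 (covers_cat ht2 vq
      (covers_link (covers1 q) l1 (covers_sym ht1))))); perm_count.
  - apply: (theta_close th (covers_link_rev hX1 l2 (covers_link_rev ht2 l1
      (covers_cat (covers1 q) qv (covers_sym ht1))))); perm_count.
have cu := uc; rewrite oedge_sym in cu.
case: hX => -[s1 [s2 [hs1 hs2 pes]]].
- apply: (theta_close th (covers_sym (covers_link hY1 l2 (covers_cat hs2 uc
    (covers_link_rev (covers1 c) l1 (covers_sym hs1)))))); perm_count.
- apply: (theta_close th (covers_sym (covers_link hY1 l2 (covers_link hs2 l1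
    (covers_cat (covers1 c) cu (covers_sym hs1)))))); perm_count.
Qed.

(** Reversing the cycle reduces the four choices of ends to the two preceding cases. *)
Lemma two_good p q c d X Y M1 M2 : perm_eq (X ++ M1 ++ Y ++ M2) (x :: A ++ y :: B) ->
  path oedge q (rcons M1 c) -> path oedge d (rcons M2 p) ->
  good x p q X \/ good x q p X -> good y c d Y \/ good y d c Y -> False.
Proof.
move=> pe l1 l2.
have pe' : perm_eq (X ++ rev M2 ++ Y ++ rev M1) (x :: A ++ y :: B) by perm_count.
have l1' := path_rev_rcons l1; have l2' := path_rev_rcons l2.
case=> gX [] gY.
- exact: good_same pe l1 l2 gX gY.
- exact: good_opposite pe l1 l2 gX gY.
- exact: good_opposite pe' l2' l1' gX gY.
- exact: good_same pe' l2' l1' gX gY.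
Qed.

(* Enlarging [X] never reaches [Y]. *)
Lemma reach_single p q c d u X Y M : perm_eq (X ++ Y ++ M) (x :: A ++ y :: B) ->
  nice x p q X -> nice y c d Y -> oedge q c -> path oedge d (rcons M p) ->
  u \in X -> u != q -> oedge c u -> False.
Proof.
move=> pe nX nY qc l2 uX uq cu.
have [_ hX _ _] := nice_extend nX qc uX uq cu.
case: nY => _ _ _ [_ _ [[EY Ec Ed]|[_ [Y1 [peY hY1]]]]].
  case: nX => _ hX1 _ _; rewrite EY in pe; rewrite Ed in l2.
  apply: (theta_close th (covers_link_rev hX1 l2 (covers1 y))); perm_count.
apply: (theta_close th (covers_link_rev hX l2 (covers_sym hY1))); perm_count.
Qed.

(** With the segments adjacent on one side, a two-sided enlargement would take the end [c] of [Y]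
    together with [b]. *)
Lemma reach_double p q c d b X Y M : perm_eq (X ++ Y ++ rcons M b) (x :: A ++ y :: B) ->
  nice x p q X -> nice y c d Y -> oedge q c -> path oedge d (rcons (rcons M b) p) ->
  oedge c b -> False.
Proof.
move=> pe [_ hXp hXq _] nY qc; rewrite rcons_path last_rcons => /andP[l2 bp] cb.
have l3 : path oedge d (rcons (rcons M b) p) by rewrite rcons_path l2 last_rcons.
case: nY => _ _ _ [_ _ [[EY Ec Ed]|[_ [Y1 [peY hY1]]]]].
  rewrite EY in pe; rewrite Ed in l3.
  apply: (theta_close th (covers_link_rev hXp l3 (covers1 y))); perm_count.
apply: (theta_close th (covers_link_rev (covers_rcons (covers_rcons hXq qc) cb) l2
  (covers_sym hY1))); perm_count.
Qed.

(** The segments make up the whole cycle. The path goes from [p] to [d], to [c] and through the rest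
    of [Y] to [y], or directly to [y] if [Y] is a single vertex. *)
Lemma reach_both p q c d X Y : perm_eq (X ++ Y) (x :: A ++ y :: B) ->
  nice x p q X -> nice y c d Y -> oedge p d -> oedge c d -> False.
Proof.
move=> pe [_ hXp _ _] nY pd; rewrite oedge_sym => dc.
case: nY => _ _ _ [_ _ [[EY Ec Ed]|[[Y1 [peY hY1]] _]]].
  rewrite EY in pe; rewrite Ed in pd.
  apply: (theta_close th (covers_rcons hXp pd)); perm_count.
apply: (theta_close th (covers_cat hXp pd (covers_cat (covers1 d) dc (covers_sym hY1)))); perm_count.
Qed.

(** From [x] the path covers [X] up to [p] and runs backwards along the rest of the cycle to [a]; an
    o-edge to [R] would close it. *)
Lemma new_far a r p X A3 B3 : perm_eq (X ++ a :: A3 ++ y :: B3) (x :: A ++ y :: B) ->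
  covers x p X -> path oedge a (rcons A3 y) -> path oedge y (rcons B3 p) -> r \in R ->
  ~~ oedge a r.
Proof.
move=> pe hX lA lB rR; apply/negP => ar.
apply: (theta_close_at th rR (covers_link_rev hX lB (covers_link_rev (covers1 y) lA (covers1 a))) ar).
by perm_count.
Qed.

Definition light X : Prop :=
  forall u v, u \in X -> v \in X -> u != v -> oedge u v -> edge u v.

Definition apart X : Prop := forall r u, r \in R -> u \in X -> u != x -> ~~ oedge u r.

(** With [a] and [b] the next vertices of the cycle beyond [q] and [p], the clauses deny the three
    enlargements. *)
Definition stuck p q X a b : Prop :=
  [/\ forall u, u \in X -> u != q -> ~~ oedge a u,
      forall u, u \in X -> u != p -> ~~ oedge b u & ~~ oedge a b].

Lemma light_cons a X : light X -> (forall u, u \in X -> oedge a u -> edge a u) -> light (a :: X).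
Proof.
move=> lX la u v; rewrite !inE => /orP[/eqP->|uX] /orP[/eqP->|vX]; rewrite ?eqxx //.
- by move=> _; apply: la.
- by move=> _; rewrite oedge_sym edge_sym; apply: la.
- exact: lX.
Qed.

Lemma perm_light X Y : perm_eq X Y -> light X -> light Y.
Proof. by move=> /perm_mem pe lX u v; rewrite -!pe; apply: lX. Qed.

End Ends.
End Theta.

(** * Growing a segment *)

Section Growth.
Variables (G : sgraph) (N : nat).
Implicit Types (a b c d p q r u v w x y z : G) (s t S X Y A B M R : seq G).
Hypothesis max_cycle :
  forall C : seq G, uniq C -> cycle oedge C -> 1 < size C -> size C <= N.

(** The defaults of [last] and [head] supply [x] and [y] themselves when [s] or [t] is empty. *)
Lemma split_link x y s M t : path edge x (rcons (s ++ M ++ t) y) ->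
  path edge (last x s) (rcons M (head y t)).
Proof.
rewrite rcons_cat cat_path rcons_cat => /andP[_].
by case: t => [|z t] //=; rewrite -cat_rcons cat_path => /andP[].
Qed.

Lemma head_cat_in y s t : s != [::] -> head y (s ++ t) \in s.
Proof. by case: s => //= z s _; rewrite mem_head. Qed.

Lemma last_cat_in y s t : s != [::] -> last y (t ++ s) \in s.
Proof. by case/lastP: s => // s z _; rewrite last_cat last_rcons mem_rcons mem_head. Qed.

Lemma light_or_good x p q X : nice x p q X ->
  (forall v, v \in X -> v != q -> oedge q v -> edge q v) \/ good x p q X.
Proof.
move=> nX; have [/hasP[v vX /and3P[vq qv nqv]]|/hasPn h] :=
  boolP (has (fun v => [&& v != q, oedge q v & ~~ edge q v]) X).
  right; apply: (nice_good nX vX vq).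
  by move: qv; rewrite /oedge (negPf nqv).
by left=> v vX vq qv; have := h v vX; rewrite vq qv negbK.
Qed.

(** [XL] precedes [x] on the cycle, at the end of [B], and [XR] follows it, at the start of [A]; on
    an empty side [x] itself is the end. *)
Definition nice_segment x XL XR : Prop :=
  nice x (head x XL) (last x XR) (XL ++ x :: XR).

(** Induction on the size of the gaps [A2] and [B2] between the two segments. The segment of [y] is
    a fixed obstacle; in the stuck outcome its sides are absorbed into [A3] and [B3]. *)
Lemma grow x y A B R YL YR : theta N x A y B R -> nice_segment y YL YR ->
  forall n XL XR A2 B2, size A2 + size B2 < n ->
  A = XR ++ A2 ++ YL -> B = YR ++ B2 ++ XL ->
  nice_segment x XL XR -> light (XL ++ x :: XR) -> apart x R (XL ++ x :: XR) ->
  (exists XL XR A2 B2, [/\ A = XR ++ A2 ++ YL, B = YR ++ B2 ++ XL, nice_segment x XL XR &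
     good x (head x XL) (last x XR) (XL ++ x :: XR) \/
     good x (last x XR) (head x XL) (XL ++ x :: XR)]) \/
  (exists XL XR A3 B3, [/\ A = XR ++ A3, B = B3 ++ XL, nice_segment x XL XR,
     light (XL ++ x :: XR) & apart x R (XL ++ x :: XR) /\
     stuck (head x XL) (last x XR) (XL ++ x :: XR) (head y A3) (last y B3)]).
Proof.
move=> th nY; elim=> // n IH XL XR A2 B2 lt EA EB nX lX aX.
set X := XL ++ x :: XR; set p := head x XL; set q := last x XR.
set a := head y (A2 ++ YL); set b := last y (YR ++ B2).
set Y := YL ++ y :: YR; set c := head y YL; set d := last y YR.
rewrite -/X -/p -/q /nice_segment -/X -/p -/q in nX lX aX.
rewrite /nice_segment -/Y -/c -/d in nY.
have pe : perm_eq (X ++ A2 ++ Y ++ B2) (x :: A ++ y :: B).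
  by rewrite EA EB /X /Y; perm_count.
have [pA pB _ [un _ _]] := th.
have l1 : path edge q (rcons A2 c) by apply: split_link; rewrite -EA.
have l2 : path edge d (rcons B2 p) by apply: split_link; rewrite -EB.
have qa : edge q a.
  by have := @split_link x y XR [::] (A2 ++ YL); rewrite /= -EA andbT; apply.
have pb : edge p b.
  have := @split_link y x (YR ++ B2) [::] XL; rewrite /= -catA -EB andbT edge_sym.
  by apply.
have /path_rev_rcons l1' := edge_path l1.
have {}un : uniq (X ++ A2 ++ Y ++ B2).
  rewrite (perm_uniq pe); apply: subseq_uniq un.
  by rewrite -!cat_cons catA prefix_subseq.
have aA : A2 != [::] -> a \in A2 by apply: head_cat_in.
have bB : B2 != [::] -> b \in B2 by apply: last_cat_in.
have [outX disj] : (forall z, z \in A2 ++ Y ++ B2 -> z \notin X) /\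
                   (forall z, z \in B2 -> z \notin A2).
  move: un; rewrite cat_uniq => /and3P[_ /hasPn h1]; rewrite cat_uniq => /and3P[_ /hasPn h2 _].
  by split=> // z zB; apply: h2; rewrite mem_cat zB orbT.
have aXl : A2 != [::] -> a \notin X by move=> /aA h; apply: outX; rewrite mem_cat h.
have bXl : B2 != [::] -> b \notin X by move=> /bB h; apply: outX; rewrite !mem_cat h !orbT.
have abN : A2 != [::] -> B2 != [::] -> a != b.
  by move=> /aA h1 /bB h2; apply: contraNneq (disj _ h2) => <-.
have far_a r z A2' : A2 = z :: A2' -> r \in R -> ~~ oedge a r.
  move=> EA2 rR; have Ea : a = z by rewrite /a EA2.
  apply: (new_far max_cycle th (p := p) (X := X) (A3 := A2' ++ YL) (B3 := YR ++ B2)) => //.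
  - by move: pe; rewrite EA2 -Ea /Y => pe; perm_count.
  - by case: nX.
  - apply: edge_path; have := @split_link x y (rcons XR z) (A2' ++ YL) [::].
    by rewrite cats0 last_rcons Ea /=; apply; rewrite cat_rcons -cat_cons -EA2 -EA.
  - by apply: edge_path; apply: (@split_link y x [::]); rewrite /= -catA -EB.
have far_b r z B2' : B2 = rcons B2' z -> r \in R -> ~~ oedge b r.
  move=> EB2 rR; have Eb : b = z by rewrite /b EB2 last_cat last_rcons.
  apply: (new_far max_cycle th (p := q) (X := X) (A3 := rev (YR ++ B2')) (B3 := rev (A2 ++ YL))) => //.
  - by move: pe; rewrite EB2 -Eb /Y => pe; perm_count.
  - by case: nX.
  - apply/path_rev_rcons/edge_path; have := @split_link y x [::] (YR ++ B2') (z :: XL).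
    by rewrite /= Eb; apply; rewrite -catA -cat_rcons -EB2 -EB.
  - apply/path_rev_rcons/edge_path; have := @split_link x y XR (A2 ++ YL) [::].
    by rewrite cats0 -EA; apply.
have Ea' z A2' : A2 = z :: A2' -> [/\ a = z, A2 != [::] & A = rcons XR a ++ A2' ++ YL].
  by move=> E; rewrite /a E EA E cat_rcons.
have Eb' z B2' : B2 = rcons B2' z -> [/\ b = z, B2 != [::] & B = YR ++ B2' ++ b :: XL].
  move=> E; rewrite /b E EB E last_cat last_rcons cat_rcons; split=> //.
  by case: (B2').
(* One-sided enlargement by [a]. If [A2] is empty, [a] is the end [c] of [Y], which [reach_single]
   excludes. *)
have [/hasP[u uX /andP[uq au]]|/hasPn n1] := boolP (has (fun u => (u != q) && oedge a u) X).
  case EA2: A2 => [|z A2'].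
    exfalso; rewrite /a EA2 /= in pe qa au l1.
    exact: (reach_single max_cycle th pe nX nY (edge_oedge qa) (edge_path l2) uX uq au).
  have [Ea A0 EA'] := Ea' _ _ EA2.
  have EX : XL ++ x :: rcons XR a = X ++ [:: a] by rewrite -cats1 -catA.
  have nX' := nice_extend nX (edge_oedge qa) uX uq au.
  have [h|gX] := light_or_good nX'.
    apply: (IH XL (rcons XR a) A2' B2) => //.
    - by move: lt; rewrite EA2 /=; clear; lia.
    - by rewrite /nice_segment last_rcons EX.
    - rewrite EX; apply: (@perm_light _ (a :: X)); first by perm_count.
      apply: light_cons => // v vX; apply: h; first by rewrite mem_cat vX.
      by apply: contraNneq (aXl A0) => <-.
    - move=> r v rR; rewrite EX mem_cat inE => /orP[vX|/eqP-> _]; first exact: aX.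
      exact: far_a EA2 rR.
  left; exists XL, (rcons XR a), A2', B2.
  by rewrite /nice_segment last_rcons EX; split=> //; left.
have [/hasP[u uX /andP[up bu]]|/hasPn n2] := boolP (has (fun u => (u != p) && oedge b u) X).
  case/lastP EB2: B2 => [|B2' z].
    exfalso; rewrite EB2 in l2; rewrite EB2 !cats0 in pe; rewrite /b EB2 !cats0 in pb bu.
    have pe' : perm_eq (X ++ Y ++ rev A2) (x :: A ++ y :: B) by perm_count.
    exact: (reach_single max_cycle th pe' (nice_sym nX) (nice_sym nY) (edge_oedge pb) l1' uX up bu).
  have [Eb B0 EB'] := Eb' _ _ EB2.
  have nX' : nice x b q (b :: X).
    apply: nice_perm (nice_sym (nice_extend (nice_sym nX) (edge_oedge pb) uX up bu)) _.
    by perm_count.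
  have [h|gX] := light_or_good (nice_sym nX').
    apply: (IH (b :: XL) XR A2 B2') => //.
    - by move: lt; rewrite EB2 size_rcons; clear; lia.
    - apply: light_cons => // v vX; apply: h; first by rewrite inE vX orbT.
      by apply: contraNneq (bXl B0) => <-.
    - move=> r v rR; rewrite inE => /orP[/eqP-> _|vX]; last exact: aX.
      exact: far_b EB2 rR.
  by left; exists (b :: XL), XR, A2, B2'; split=> //; right.
(* No one-sided enlargement is left: either [a] and [b] are added together, or the segment is
   stuck. *)
have [ab|nab] := boolP (oedge a b); last first.
  right; exists XL, XR, (A2 ++ YL), (YR ++ B2); split=> //; first by rewrite -catA.
  by split=> //; split=> // [u uX uq|u uX up]; [have := n1 u uX; rewrite uq|have := n2 u uX; rewrite up].
case EA2: A2 => [|z A2'].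
  exfalso; rewrite /a EA2 /= in pe qa ab.
  case/lastP EB2: B2 => [|B2' z]; rewrite EB2 in pe l2.
    rewrite !cats0 in pe; rewrite /b EB2 !cats0 in pb ab.
    exact: (reach_both max_cycle th pe nX nY (edge_oedge pb) ab).
  have [Eb _ _] := Eb' _ _ EB2; rewrite Eb in ab.
  exact: (reach_double max_cycle th pe nX nY (edge_oedge qa) (edge_path l2) ab).
have [Ea A0 EA'] := Ea' _ _ EA2.
case/lastP EB2: B2 => [|B2' z'].
  exfalso; rewrite EB2 in l2; rewrite EB2 !cats0 in pe; rewrite /b EB2 !cats0 in pb ab.
  have pe' : perm_eq (X ++ Y ++ rcons (rev A2') z) (x :: A ++ y :: B).
    by rewrite EA2 in pe; perm_count.
  rewrite EA2 rev_cons in l1'; rewrite oedge_sym Ea in ab.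
  exact: (reach_double max_cycle th pe' (nice_sym nX) (nice_sym nY) (edge_oedge pb) l1' ab).
have [Eb B0 EB'] := Eb' _ _ EB2.
have EX : (b :: XL) ++ x :: rcons XR a = b :: X ++ [:: a] by rewrite /= -cats1 /X -catA.
have nX' := nice_extend2 nX (edge_oedge qa) (edge_oedge pb) ab.
have nS : nice_segment x (b :: XL) (rcons XR a) by rewrite /nice_segment last_rcons EX.
have [h|gX] := light_or_good nX'; last first.
  left; exists (b :: XL), (rcons XR a), A2', B2'; split=> //.
  by rewrite last_rcons EX; left.
have [h'|gX] := light_or_good (nice_sym nX'); last first.
  left; exists (b :: XL), (rcons XR a), A2', B2'; split=> //.
  by rewrite last_rcons EX; right.
apply: (IH (b :: XL) (rcons XR a) A2' B2') => //.
- by move: lt; rewrite EA2 EB2 size_rcons /=; clear; lia.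
- rewrite EX; apply: (@perm_light _ (b :: a :: X)); first by perm_count.
  have neb := abN A0 B0.
  apply: light_cons => [|v].
    apply: light_cons => // v vX; apply: h; first by rewrite inE mem_cat vX orbT.
    by apply: contraNneq (aXl A0) => <-.
  rewrite inE => vaX; apply: h'; first by rewrite inE mem_cat inE; case/orP: vaX => ->; rewrite !orbT.
  case/orP: vaX => [/eqP-> //|vX]; by apply: contraNneq (bXl B0) => <-.
- move=> r v rR; rewrite EX inE mem_cat inE => /or3P[/eqP-> _|vX|/eqP-> _].
  + exact: far_b EB2 rR.
  + exact: aX.
  + exact: far_a EA2 rR.
Qed.

End Growth.

(** * Pairs that are not heavy *)

Lemma count_prefix (T : Type) (a : pred T) (x0 : T) (s : seq T) k :
  (forall i, i < size s -> a (nth x0 s i) -> i + k < size s) ->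
  count a s = count a (take (size s - k) s).
Proof.
move=> h; rewrite -[in LHS](cat_take_drop (size s - k) s) count_cat.
suff /eqP -> : count a (drop (size s - k) s) == 0 by rewrite addn0.
rewrite -leqn0 leqNgt -has_count; apply/negP => /(has_nthP x0) [i].
rewrite size_drop nth_drop => lt ai; have := h (size s - k + i) _ ai.
by move: lt; clear; lia.
Qed.

Lemma count_suffix (T : Type) (a : pred T) (x0 : T) (s : seq T) k :
  (forall i, i < size s -> a (nth x0 s i) -> k <= i) -> count a s = count a (drop k s).
Proof.
move=> h; rewrite -[in LHS](cat_take_drop k s) count_cat.
suff /eqP -> : count a (take k s) == 0 by [].
rewrite -leqn0 leqNgt -has_count; apply/negP => /(has_nthP x0) [i].
rewrite size_take_min => lt; have ik : i < k by move: lt; clear; lia.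
rewrite nth_take // => ai; have := h i _ ai.
by move: lt ik; clear; lia.
Qed.

Lemma count_disjoint (T : Type) (a b : pred T) (x0 : T) (s t : seq T) : size s = size t ->
  (forall i, i < size s -> ~~ (a (nth x0 s i) && b (nth x0 t i))) ->
  count a s + count b t <= size s.
Proof.
elim: s t => [|u s IH] [|v t] //= [sz] h.
have := IH t sz (fun i => h i.+1); have := h 0 isT => /=.
by case: (a u); case: (b v) => //=; clear; lia.
Qed.

Section HeavyEnds.
Variables (G : sgraph) (N : nat).
Implicit Types (a b c d k p q r u v w x y z : G) (s t S X Y A B K L M R : seq G).
Hypothesis max_cycle :
  forall C : seq G, uniq C -> cycle oedge C -> 1 < size C -> size C <= N.
Hypothesis hclaw : graph_heavy claw G.

Lemma covers_upto x y A A1 p A2 : path edge x (rcons A y) -> A = A1 ++ p :: A2 ->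
  covers (head y A) p (rcons A1 p).
Proof.
move=> pA EA; rewrite EA -cat_rcons rcons_cat cat_path in pA *.
case/andP: pA => pA _; case: A1 {EA} pA => [|u t] /=; first by move=> _; apply: covers1.
by case/andP=> _ /edge_path/covers_path; rewrite last_rcons.
Qed.

Lemma covers_from x y A A1 p A2 : path edge x (rcons A y) -> A = A1 ++ p :: A2 ->
  covers p (last x A) (p :: A2).
Proof.
move=> pA EA; move: pA; rewrite EA rcons_cat cat_path /= rcons_path => /and4P[_ _ pA _].
by rewrite last_cat; apply: covers_path (edge_path pA).
Qed.

Lemma theta_mirror x A y B R : theta N x A y B R -> theta N x (rev B) y (rev A) R.
Proof.
case=> pA pB pR [un sz R0]; split=> //; try exact: edge_path_rev.
split=> //; last by rewrite !size_rev addnC.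
suff /perm_uniq -> : perm_eq (x :: rev B ++ y :: rev A ++ R) (x :: A ++ y :: B ++ R) by [].
by perm_count.
Qed.

(** If [x] and [y] were consecutive on the cycle, going round the other way would cover it by a path
    from [x] to [y]. *)
Lemma theta_nil x A y B R : theta N x A y B R -> A != [::] /\ B != [::].
Proof.
move=> th; have [pA pB _ _] := th; split; apply/negP => /eqP E; rewrite E in th pA pB.
- apply: (theta_close max_cycle th
    (covers_link_rev (covers1 x) (edge_path pB) (covers1 y))); perm_count.
- apply: (theta_close max_cycle th
    (covers_link (covers1 x) (edge_path pA) (covers1 y))); perm_count.
Qed.

(** Otherwise [k] could be inserted between [x] and its successor [a]. *)
Lemma outside_far x a A y B R k : theta N x (a :: A) y B R -> edge x k ->
  k \notin x :: (a :: A) ++ y :: B -> ~~ oedge a k.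
Proof.
move=> th xk kC; have [pA pB _ [un sz _]] := th; apply/negP => ak.
have pA' : path edge a (rcons A y) by case/andP: pA.
have h := covers_link_rev (covers_link_rev (covers1 x) (edge_path pB) (covers1 y))
  (edge_path pA') (covers1 a).
have pk : path oedge x [:: k; a] by rewrite /= (edge_oedge xk) oedge_sym ak.
have := covers_close max_cycle h (M := [:: k]) pk.
set S := _ ++ [:: k].
have pe : perm_eq S (k :: x :: (a :: A) ++ y :: B) by rewrite /S; perm_count.
have un' : uniq (x :: (a :: A) ++ y :: B).
  by apply: subseq_uniq un; rewrite -!cat_cons catA prefix_subseq.
rewrite (perm_uniq pe) (perm_size pe) cons_uniq kC un' /=.
by rewrite size_cat /= => /(_ isT isT); move: sz => /=; clear; lia.
Qed.

Lemma R_outside x A y B R r : theta N x A y B R -> r \in R -> r \notin x :: A ++ y :: B.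
Proof.
case=> _ _ _ [un _ _] rR; move: un.
rewrite -!cat_cons catA cat_uniq => /and3P[_ /hasPn h _]; exact: h.
Qed.

Lemma nbr_far x a A y B R r : theta N x (a :: A) y B R -> r \in R -> ~~ oedge a r.
Proof.
move=> th rR; have [/= /andP[_ pA] pB _ _] := th.
apply: (new_far max_cycle th _ (covers1 x) (edge_path pA) (edge_path pB) rR).
by perm_count.
Qed.

(** Claw at [x] whose third leaf is the successor of [x] on the cycle, which is o-adjacent to
    neither [k] nor [k']. *)
Lemma outside_clique x A y B R k k' : theta N x A y B R -> edge x k -> edge x k' ->
  k \notin x :: A ++ y :: B -> k' \notin x :: A ++ y :: B -> k != k' -> oedge k k'.
Proof.
move=> th xk xk' kC kC' kk; have [A0 _] := theta_nil th.
case: A A0 th kC kC' => // a A _ th kC kC'.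
have xa : edge x a by case: th => /andP[].
have ak := outside_far th xk kC; have ak' := outside_far th xk' kC'.
have neq u : u \notin x :: (a :: A) ++ y :: B -> u != a.
  by apply: contraNneq => ->; rewrite inE mem_cat mem_head orbT.
have := claw_oedge hclaw xk xk' xa kk (neq _ kC) (neq _ kC').
by rewrite ![oedge _ a]oedge_sym (negPf ak) (negPf ak') !orbF.
Qed.

(** Claw at [x] formed by its two neighbours on the cycle and the first vertex of [R], which is
    o-adjacent to neither. *)
Lemma shortcut x A y B R : theta N x A y B R -> oedge (last y B) (head y A).
Proof.
move=> th; have [A0 B0] := theta_nil th; have thm := theta_mirror th.
have [pA pB pR [un _ R0]] := th.
case: A A0 th thm pA un => // a A _ th thm /= /andP[xa _] un.
case/lastP: B B0 th thm pB un => // B b _ th thm pB un; rewrite last_rcons.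
case: R R0 th thm pR un => // z R _ th thm /andP[xz _] un.
have xb : edge x b by move: pB; rewrite !rcons_path last_rcons => /andP[_]; rewrite edge_sym.
have az := nbr_far th (mem_head z R); rewrite rev_rcons in thm.
have bz := nbr_far thm (mem_head z R).
have ab : a != b.
  apply: contraTneq un => ->.
  have bin : b \in A ++ y :: rcons B b ++ z :: R.
    by rewrite mem_cat inE mem_cat mem_rcons mem_head !orbT.
  by rewrite /= bin !andbF.
have Rz : z \in z :: R by exact: mem_head.
have zC := R_outside th Rz.
have za : z != a by apply: contraNneq zC => ->; rewrite inE mem_cat mem_head orbT.
have zb : z != b.
  by apply: contraNneq zC => ->; rewrite inE mem_cat !inE mem_rcons mem_head !orbT.
have := claw_oedge hclaw xz xa xb za zb ab.
by rewrite ![oedge z _]oedge_sym (negPf az) (negPf bz) /= oedge_sym.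
Qed.

(** * Gaps between neighbours on the cycle forced by a detour *)

Section Detour.
Variables (x y : G) (A B R L : seq G).
Hypotheses (th : theta N x A y B R) (pL : path oedge x (rcons L y))
  (uL : uniq (x :: A ++ y :: B ++ L)).

(** [L] need not be [R]. It closes a path omitting only [D], and the resulting cycle has
    [N - size D + size L] vertices. *)
Lemma detour_close S D : covers x y S -> perm_eq (S ++ D) (x :: A ++ y :: B) ->
  size L <= size D.
Proof.
move=> hS pe; have pe' : perm_eq ((S ++ L) ++ D) (x :: A ++ y :: B ++ L) by perm_count.
move: uL; rewrite -(perm_uniq pe') cat_uniq => /andP[un _].
have sz := perm_size pe; have [_ _ _ [_ szN _]] := th.
have [xS yS] := andP (covers_mem hS).
have S1 : 1 < size S.
  case: S xS yS {hS pe pe' un sz} => [|u [|v S]] //; rewrite !inE => /eqP Eu /eqP Ev.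
  by move: uL; rewrite Eu -Ev cons_uniq mem_cat mem_head orbT.
have := covers_close max_cycle hS pL un; rewrite !size_cat.
by move: S1 sz szN; rewrite /= !size_cat /=; clear; lia.
Qed.

(* Running along [L], then [B], then [A] up to the neighbour of [x] omits only the
   end of [A]. *)
Lemma gap_start i : i < size A -> edge x (nth x A i) -> i + size L < size A.
Proof.
move=> lt xp; set p := nth x A i in xp.
have EA : A = take i A ++ p :: drop i.+1 A by rewrite -drop_nth // cat_take_drop.
have [A0 B0] := theta_nil th; have sc := shortcut th; have [pA pB _ _] := th.
have hB : covers y (last y B) (y :: B).
  by apply/covers_path/edge_path; move: pB; rewrite rcons_path => /andP[].
have hA := covers_upto pA EA.
have px : oedge p x by rewrite oedge_sym edge_oedge.
have h := covers_sym (covers_rcons (covers_cat hB sc hA) px).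
have /detour_close : covers x y (((y :: B) ++ rcons (take i A) p) ++ [:: x]) by [].
move=> /(_ (drop i.+1 A)); rewrite size_drop => le; have : size L <= size A - i.+1.
  apply: le; have pe : perm_eq A (take i A ++ p :: drop i.+1 A) by rewrite -EA.
  by perm_count.
by move: lt; clear; lia.
Qed.

(** The path goes from [x] to [p], back to the start of [A], by [shortcut] at [x] to the end of [B],
    back along [B], by [shortcut] at [y] to the end of [A], back to [p'] and to [y]. It omits what
    lies between [p] and [p']. *)
Lemma gap_middle i j : i < j < size A -> edge x (nth x A i) -> edge y (nth x A j) ->
  i + size L < j.
Proof.
move=> /andP[ij lt] xp yp'; set p := nth x A i in xp; set p' := nth x A j in yp'.
set A1 := take i A; set A2 := drop i.+1 (take j A); set A3 := drop j.+1 A.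
have EA : A = A1 ++ p :: A2 ++ p' :: A3.
  rewrite -{1}(cat_take_drop j A) (drop_nth x) // -/p' -/A3.
  rewrite -{1}(cat_take_drop i (take j A)) (drop_nth x) ?size_takel ?(ltnW lt) //.
  by rewrite nth_take // -/p -/A2 take_takel ?(ltnW ij) // -/A1 -catA.
have [A0 B0] := theta_nil th; have sc := shortcut th; have [pA pB _ _] := th.
have sc' := shortcut (theta_swap th).
have hB : covers (last y B) (head x B) B.
  case: B B0 pB => // b B' _; rewrite /= rcons_path => /and3P[_ pB' _].
  exact: covers_sym (covers_path (edge_path pB')).
have hA1 := covers_sym (covers_upto pA EA).
have EA' : A = (A1 ++ p :: A2) ++ p' :: A3 by rewrite -catA.
have hA3 := covers_sym (covers_from pA EA').
have xp_o := edge_oedge xp; have p'y : oedge p' y by rewrite oedge_sym edge_oedge.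
rewrite oedge_sym in sc; rewrite oedge_sym in sc'.
have h := covers_cat (covers1 x) xp_o (covers_cat hA1 sc (covers_cat hB sc'
  (covers_rcons hA3 p'y))).
have le : size L <= size A2.
  apply: (detour_close h); have pe : perm_eq A (A1 ++ p :: A2 ++ p' :: A3) by rewrite -EA.
  by perm_count.
move: le; rewrite size_drop size_takel ?(ltnW lt) //.
by move: ij; clear; lia.
Qed.

End Detour.

Lemma theta_rev x A y B R : theta N x A y B R -> theta N y (rev A) x (rev B) (rev R).
Proof. by move/theta_mirror/theta_swap. Qed.

(** Neighbours of [x] avoid the last [size L] places of [A], those of [y] the first [size L].
    Shifted by [size L], the latter are disjoint from the former by [gap_middle], within
    [size A - size L] places. *)
Lemma side_count x A y B R L : theta N x A y B R -> path oedge x (rcons L y) ->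
  uniq (x :: A ++ y :: B ++ L) -> 0 < size L ->
  count (edge x) A + count (edge y) A + size L <= size A.
Proof.
move=> th pL uL L0; have [A0 _] := theta_nil th.
have lt : size L < size A.
  case: A A0 th uL => // a A _ th uL; have [/andP[xa _] _ _ _] := th.
  exact: (gap_start th pL uL (i := 0)).
have uL' : uniq (y :: rev A ++ x :: rev B ++ rev L).
  suff /perm_uniq -> : perm_eq (y :: rev A ++ x :: rev B ++ rev L) (x :: A ++ y :: B ++ L) by [].
  by perm_count.
have gap_end j : j < size A -> edge y (nth x A j) -> size L <= j.
  move=> jlt yj; have := gap_start (theta_rev th) (path_rev_rcons pL) uL' (i := size A - j.+1).
  rewrite size_rev size_rev (set_nth_default x) ?size_rev ?nth_rev; try by move: jlt; clear; lia.
  rewrite (_ : size A - (size A - j.+1).+1 = j); last by move: jlt; clear; lia.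
  by move=> h; have := h _ yj; move: jlt; clear; lia.
rewrite (count_prefix (x0 := x) (k := size L)); last by move=> i; apply: gap_start th pL uL i.
rewrite (count_suffix (a := edge y) (x0 := x) (k := size L)) //.
suff : count (edge x) (take (size A - size L) A) + count (edge y) (drop (size L) A)
       <= size (take (size A - size L) A).
  by rewrite size_takel ?leq_subr //; move: lt; clear; lia.
apply: (count_disjoint (x0 := x)); first by rewrite size_takel ?leq_subr // size_drop.
rewrite size_takel ?leq_subr // => i ilt; rewrite nth_take // nth_drop.
apply/negP => /andP[xi yi].
have := gap_middle th pL uL (i := i) (j := size L + i) _ xi yi.
by move: ilt L0; clear; lia.
Qed.

End HeavyEnds.

(** * Degree counts at the ends of the outside path *)

Section LightEnds.
Variables (G : sgraph) (N : nat).
Implicit Types (a b c d k p q r u v w x y z : G) (s t S X Y A B K L M R : seq G).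
Hypothesis max_cycle :
  forall C : seq G, uniq C -> cycle oedge C -> 1 < size C -> size C <= N.
Hypothesis hclaw : graph_heavy claw G.

Definition outside_nbrs x s : seq G := enum [set w | edge x w & w \notin s].

Lemma mem_outside_nbrs x s k : (k \in outside_nbrs x s) = edge x k && (k \notin s).
Proof. by rewrite mem_enum inE. Qed.

Lemma path_clique x s : uniq s -> (forall u, u \in s -> oedge x u) ->
  (forall u v, u \in s -> v \in s -> u != v -> oedge u v) -> path oedge x s.
Proof.
elim: s x => //= u s IH x /andP[us un] hx hs; rewrite hx ?mem_head //=.
apply: IH => // [v vs|v w vs ws]; apply: hs; rewrite ?inE ?vs ?ws ?eqxx ?orbT //.
by apply: contraNneq us => ->.
Qed.

Lemma count_le1 (a : pred G) s : uniq s ->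
  (forall u v, u \in s -> v \in s -> a u -> a v -> u = v) -> count a s <= 1.
Proof.
elim: s => //= u s IH /andP[us un] h; have [au|_] := boolP (a u); last first.
  by apply: IH => // v w vs ws; apply: h; rewrite inE ?vs ?ws orbT.
rewrite (_ : count a s = 0) //; apply/eqP; rewrite -leqn0 leqNgt -has_count.
apply/hasPn => v vs; apply: contraNN us => av.
by rewrite (h u v) ?mem_head // inE vs orbT.
Qed.

Lemma theta_uniq x A y B R : theta N x A y B R ->
  uniq (x :: A ++ y :: B) /\ size (x :: A ++ y :: B) = N.
Proof.
case=> _ _ _ [un sz _]; split; first by apply: subseq_uniq un; rewrite -!cat_cons catA prefix_subseq.
by rewrite -sz /= size_cat /=; clear; lia.
Qed.

Lemma card_outside x s : uniq s -> #|[set w | edge x w & w \notin s]| + size s <= #|G|.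
Proof.
move=> un; have := cardsC [set w in s]; rewrite cardsE (card_uniqP un) => <-.
rewrite addnC leq_add2l; apply/subset_leq_card/subsetP => w.
by rewrite in_setC !in_set => /andP[].
Qed.

(* The neighbours of [x] outside the cycle are pairwise joined by o-edges, so a detour
   can take them all; the longer it is, the fewer neighbours [x] has on [A]. *)
Lemma tail_light x A y B z1 z2 R : theta N x A y B (z1 :: z2 :: R) ->
  (forall r, r \in z2 :: R -> ~~ edge x r) ->
  (forall u v, u \in x :: A ++ y :: B -> v \in x :: A ++ y :: B ->
     edge z2 u -> edge z2 v -> u = v) ->
  ~~ oedge x z2.
Proof.
move=> th nxR one; have [unC szC] := theta_uniq th.
set C := x :: A ++ y :: B in one unC szC.
have [pA pB pR [unR _ _]] := th.
pose K0 := outside_nbrs x C; pose K := rem z1 K0.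
have xz1 : edge x z1 by case/andP: pR.
have z1K : z1 \in K0.
  by rewrite mem_outside_nbrs xz1; apply: (R_outside th); rewrite mem_head.
have un0 : uniq K0 by apply: enum_uniq.
have peK : perm_eq K0 (z1 :: K) by apply: perm_to_rem.
have memK k : k \in rcons K z1 -> edge x k /\ k \notin C.
  by rewrite mem_rcons -(perm_mem peK) mem_outside_nbrs => /andP[].
have unK : uniq (rcons K z1) by rewrite rcons_uniq -cons_uniq -(perm_uniq peK).
(* From [x] the detour visits all its other outside neighbours before following the given path. *)
set L := K ++ z1 :: z2 :: R.
have pL : path oedge x (rcons L y).
  rewrite /L -cat_rcons rcons_cat cat_path last_rcons; apply/andP; split.
    apply: path_clique => // [u /memK[/edge_oedge]//|u v /memK[xu uC] /memK[xv vC]].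
    exact: (outside_clique max_cycle hclaw th).
  by apply: edge_path; case/andP: pR.
have uL : uniq (x :: A ++ y :: B ++ L).
  suff : uniq (C ++ L) by rewrite /C /= -catA.
  rewrite cat_uniq unC /= /L -cat_rcons; apply/andP; split.
    apply/hasPn => k; rewrite mem_cat => /orP[/memK[]//|kR].
    by apply: (R_outside th); rewrite inE kR orbT.
  rewrite cat_uniq unK andTb; apply/andP; split.
    apply/hasPn => k kR; apply/negP => /memK[xk _].
    by move: (nxR k kR); rewrite xk.
  move: unR; rewrite -!cat_cons catA cat_uniq => /and3P[_ _] /=.
  by case/and3P=> _ -> ->.
have [A0 _] := theta_nil max_cycle th.
have gap := gap_start max_cycle hclaw th pL uL.
have ltL : size L < size A.
  have xa : edge x (nth x A 0) by case: (A) A0 pA => // a A' _ /andP[].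
  by apply: (gap 0) xa; rewrite lt0n size_eq0.
have cA : count (edge x) A <= size A - size L.
  by rewrite (count_prefix (x0 := x) gap) (leq_trans (count_size _ _)) // size_takel ?leq_subr.
have cB := count_size (edge x) B.
have dx := degree_count x unC; have dz := degree_count z2 unC.
have c1 := count_le1 unC one.
have co := card_outside z2 unC.
rewrite {1}/C /= count_cat /= edge_irrefl in dx.
have szK0 : #|[set w | edge x w & w \notin C]| = size K0 by rewrite /K0 /outside_nbrs -cardE.
rewrite szK0 (perm_size peK) /= in dx.
have szL : size L = size K + (size R).+2 by rewrite /L size_cat.
(* The degree of [x] is at most [size A + size B - size R]. That of [z2] is at most
   [#|G| - size A - size B - 1], with at most one neighbour on the cycle. *)
rewrite /oedge (negPf (nxR z2 _)) ?mem_head //= -ltnNge.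
have szC' : size C = (size A + size B).+2 by rewrite /C /= size_cat /=; clear; lia.
rewrite {}szC' in co; rewrite {}szL in cA ltL.
have : nat_of_bool (edge x y) <= 1 by case: (edge x y).
move: dx dz c1 co cA cB ltL; rewrite add0n.
clear; simpl; lia.
Qed.

(** The detour [L] takes all outside neighbours of [x] and of [y], with [z] linking the two cliques.
    [side_count] on both arcs costs [size L] twice, and the outside neighbours regain at most that,
    so the degree sum is at most [N - 2]. *)
Lemma ends_light x A y B z : theta N x A y B [:: z] -> ~~ edge x y -> ~~ oedge x y.
Proof.
move=> th nxy; have [unC szC] := theta_uniq th.
set C := x :: A ++ y :: B in unC szC.
have [pA pB pR [unR szN _]] := th.
have [xz zy] : edge x z /\ edge z y by case/and3P: pR.
have zC : z \notin C by apply: (R_outside th); rewrite mem_head.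
pose Kx := outside_nbrs x C; pose Ky := outside_nbrs y C.
pose K1 := rem z Kx; pose K2 := [seq k <- Ky | k \notin Kx].
have zK : z \in Kx by rewrite mem_outside_nbrs xz.
have [unx uny] : uniq Kx /\ uniq Ky by split; apply: enum_uniq.
have peK : perm_eq Kx (z :: K1) by apply: perm_to_rem.
have mem1 k : k \in rcons K1 z = (k \in Kx) by rewrite mem_rcons -(perm_mem peK).
have unK : uniq (rcons K1 z) by rewrite rcons_uniq -cons_uniq -(perm_uniq peK).
have mem2 k : k \in K2 -> [/\ edge y k, k \notin C & k \notin Kx].
  by rewrite mem_filter => /andP[kx]; rewrite mem_outside_nbrs => /andP[].
set L := K1 ++ z :: K2.
have memC' k : (k \notin y :: B ++ x :: A) = (k \notin C).
  congr (~~ _); apply: perm_mem; rewrite /C; perm_count.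
have ths := theta_swap th.
have pL : path oedge x (rcons L y).
  rewrite /L -cat_rcons rcons_cat cat_path last_rcons; apply/andP; split.
    apply: path_clique => // [u|u v]; rewrite !mem1 !mem_outside_nbrs.
      by case/andP=> /edge_oedge.
    move=> /andP[xu uC] /andP[xv vC]; exact: (outside_clique max_cycle hclaw th).
  have zy' : edge y z by rewrite edge_sym.
  rewrite rcons_path; apply/andP; split.
    apply: path_clique => [|u /mem2[yu uC uK]|u v /mem2[yu uC _] /mem2[yv vC _]].
    - exact: filter_uniq.
    - apply: (outside_clique max_cycle hclaw ths zy' yu); rewrite ?memC' //.
      by apply: contraNneq uK => <-.
    - by apply: (outside_clique max_cycle hclaw ths yu yv); rewrite ?memC'.
  apply: edge_oedge; have := mem_last z K2; rewrite inE => /orP[/eqP->//|/mem2[]].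
  by rewrite edge_sym.
have unL : uniq L.
  rewrite /L -cat_rcons cat_uniq unK filter_uniq // andbT.
  by apply/hasPn => k /mem2[_ _ kx]; rewrite /= mem1.
have memL k : k \in L = (k \in Kx) || (k \in Ky).
  by rewrite /L -cat_rcons mem_cat mem1 [k \in K2]mem_filter; case: (k \in Kx).
have uL : uniq (x :: A ++ y :: B ++ L).
  suff : uniq (C ++ L) by rewrite /C /= -catA.
  rewrite cat_uniq unC unL andbT; apply/hasPn => k.
  by rewrite memL !mem_outside_nbrs => /orP[] /andP[].
have uLs : uniq (y :: B ++ x :: A ++ rev L).
  suff /perm_uniq -> : perm_eq (y :: B ++ x :: A ++ rev L) (x :: A ++ y :: B ++ L) by [].
  by perm_count.
have L0 : 0 < size L by rewrite /L size_cat /=; clear; lia.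
have L0' : 0 < size (rev L) by rewrite size_rev.
have cA := side_count max_cycle hclaw th pL uL L0.
have cB := side_count max_cycle hclaw ths (path_rev_rcons pL) uLs L0'.
rewrite size_rev in cB.
have dx := degree_count x unC; have dy := degree_count y unC.
have ox : #|[set w | edge x w & w \notin C]| <= size L.
  rewrite cardE -/(outside_nbrs x C); apply: uniq_leq_size => // k.
  by rewrite memL => ->.
have oy : #|[set w | edge y w & w \notin C]| <= size L.
  rewrite cardE -/(outside_nbrs y C); apply: uniq_leq_size => // k.
  by rewrite memL => ->; rewrite orbT.
have Nn : size C <= #|G| by rewrite -(card_uniqP unC) max_card.
rewrite szC in Nn.
have {dx} dx : degree x <= count (edge x) A + count (edge x) B + size L.
  rewrite dx leq_add // /C /= count_cat /= edge_irrefl (negPf nxy).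
  by clear; lia.
have {dy} dy : degree y <= count (edge y) A + count (edge y) B + size L.
  rewrite dy leq_add // /C /= count_cat /= edge_irrefl edge_sym (negPf nxy).
  by clear; lia.
rewrite /oedge (negPf nxy) /= -ltnNge.
move: cA cB dx dy Nn szN; clear; simpl; lia.
Qed.

End LightEnds.

(** * A segment that stops growing *)

Section Stuck.
Variables (G : sgraph) (N : nat).
Implicit Types (a b c d k p q r u v w x y z : G) (s t S X Y A B K L M R : seq G).
Hypothesis max_cycle :
  forall C : seq G, uniq C -> cycle oedge C -> 1 < size C -> size C <= N.
Hypotheses (hclaw : graph_heavy claw G) (hN : graph_heavy N112 G) (hdeer : graph_heavy deer G).

Lemma path_connected h s : path edge h s ->
  forall u v, u \in h :: s -> v \in h :: s ->
  exists r : seq G, [/\ path edge u r, all (fun w => w \in h :: s) r & last u r = v].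
Proof.
set V := h :: s; pose e := [rel u v : G | [&& edge u v, u \in V & v \in V]].
move=> ps; have pe : path e h s.
  rewrite (eq_in_path (P := fun w => w \in V) (e' := edge)) //.
    by move=> u v uV vV; rewrite /e /= uV vV !andbT.
have sym : connect_sym e.
  by apply: sym_connect_sym => u v; rewrite /e /= edge_sym [in RHS]andbCA andbA [in RHS]andbC -!andbA.
have conn u : u \in V -> connect e h u by move=> uV; apply: path_connect pe _ uV.
move=> u v uV vV; have /connectP[r pr ->] : connect e u v.
  by apply: connect_trans (conn v vV); rewrite sym conn.
exists r; split=> //; first by apply: sub_path pr => a b /and3P[].
elim: r u {uV} pr => //= w r IH u /andP[/and3P[_ _ ->]]; exact: IH.
Qed.

(* Minimality of [R]: either a common neighbour of [x] and [y], or no vertex of [R]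
   has two neighbours on the cycle and [R] has no chord at its ends. *)
Definition tame x A y B R : Prop :=
  (exists z, R = [:: z]) \/
  [/\ forall r u v, r \in R -> u \in x :: A ++ y :: B -> v \in x :: A ++ y :: B ->
        edge r u -> edge r v -> u = v,
      forall r, r \in behead R -> ~~ edge x r &
      forall r, r \in behead (rev R) -> ~~ edge y r].

Lemma covers_segment u v w M : path edge u (rcons M v) -> M != [::] ->
  covers (head v M) (last w M) M.
Proof.
case: M => // m M /= /andP[_]; rewrite rcons_path => /andP[pM _] _.
exact: covers_path (edge_path pM).
Qed.

(** * Contradiction from a stuck segment *)

Section Endgame.
Variables (x y : G) (A B R XL XR A3 B3 : seq G).
Let X := XL ++ x :: XR.
Let p := head x XL.
Let q := last x XR.
Let a := head y A3.
Let b := last y B3.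
Hypotheses (th : theta N x A y B R) (EA : A = XR ++ A3) (EB : B = B3 ++ XL)
  (nX : nice_segment x XL XR) (lX : light X) (aX : apart x R X) (stX : stuck p q X a b).

Let linkA : path edge q (rcons A3 y).
Proof. by have [pA _ _ _] := th; apply: (@split_link _ x y XR A3 [::]); rewrite cats0 -EA. Qed.

Let linkB : path edge y (rcons B3 p).
Proof. by have [_ pB _ _] := th; apply: (@split_link _ y x [::] B3 XL); rewrite -EB. Qed.

Let permC : perm_eq (X ++ A3 ++ y :: B3) (x :: A ++ y :: B).
Proof. by rewrite EA EB /X; perm_count. Qed.

(** Otherwise an end of [X] would be next to [y], and a path covering [X] from [x] to its other end
    could go on round the cycle to [y]. *)
Lemma stuck_nonnil : A3 != [::] /\ B3 != [::].
Proof.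
have [_ hp hq _] := nX; split; apply/negP => /eqP E.
  apply: (theta_close max_cycle th (covers_link_rev hp (edge_path linkB) (covers1 y))).
  by move: permC; rewrite E => ?; perm_count.
apply: (theta_close max_cycle th (covers_link hq (edge_path linkA) (covers1 y))).
by move: permC; rewrite E => ?; perm_count.
Qed.

Lemma stuck_far r : r \in R -> ~~ oedge a r /\ ~~ oedge b r.
Proof.
move=> rR; have [A0 B0] := stuck_nonnil; have [_ hp hq _] := nX.
move: linkA linkB permC; rewrite /a /b.
case: (A3) A0 => // a' A4 _; case/lastP: (B3) B0 => // B4 b' _ lA lB pe.
rewrite last_rcons; split.
  apply: (new_far max_cycle th pe hp _ (edge_path lB) rR).
  by apply: edge_path; case/andP: lA.
apply: (new_far max_cycle th (A3 := rev B4) (B3 := rev (a' :: A4)) (X := X) _ hq _ _ rR).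
- by perm_count.
- apply/path_rev_rcons/edge_path; move: lB; rewrite rcons_path last_rcons.
  by case/andP.
- exact/path_rev_rcons/edge_path.
Qed.

Lemma stuck_edges : edge q a /\ edge p b.
Proof.
have [A0 B0] := stuck_nonnil; split.
  by move: linkA; rewrite /a; case: (A3) A0 => // a' A4 _ /andP[].
move: linkB; rewrite /b; case/lastP: (B3) B0 => // B4 b' _.
by rewrite rcons_path last_rcons edge_sym => /andP[].
Qed.

(** Instance of [three_pendants] for [X], with [a], [b] and the first vertex of [R] pendant at [q],
    [p] and [x]. *)
Lemma stuck_triangle : [/\ edge q p, edge q x & edge p x].
Proof.
have [A0 B0] := stuck_nonnil; have [qa pb] := stuck_edges; have [st1 st2 st3] := stX.
have [unC _] := theta_uniq th.
have unX : uniq (X ++ A3 ++ y :: B3) by rewrite (perm_uniq permC).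
have [aA bB] : a \in A3 /\ b \in B3.
  split; first by have := @head_cat_in _ y A3 [::] A0; rewrite cats0.
  exact: (@last_cat_in _ y B3 [::] B0).
move: unX; rewrite cat_uniq => /and3P[_ /hasPn outX _].
have aNX : a \notin X by apply: outX; rewrite mem_cat aA.
have bNX : b \notin X by apply: outX; rewrite mem_cat inE bB !orbT.
have [_ pB pR [_ _ R0]] := th.
have [z [zR xz]] : exists z, z \in R /\ edge x z.
  by case: (R) R0 pR => // z R' _ /andP[xz _]; exists z; rewrite mem_head.
have zC := R_outside th zR.
have zNX : z \notin X by apply: contraNN zC => zX; rewrite -(perm_mem permC) mem_cat zX.
have az : a != z.
  by apply: contraNneq zC => <-; rewrite -(perm_mem permC) !mem_cat aA orbT.
have bz : b != z.
  by apply: contraNneq zC => <-; rewrite -(perm_mem permC) !mem_cat [b \in y :: B3]inE bB !orbT.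
have [faz fbz] := stuck_far zR.
have ab : a != b.
  have [unC' _] := theta_uniq th; move: unC'; rewrite -(perm_uniq permC) !cat_uniq.
  case/and3P=> _ _ /and3P[_ /hasPn h _]; apply/eqP => E.
  by have := h b; rewrite inE bB orbT /= -E aA => /(_ isT).
have [hp hq] : p \in X /\ q \in X.
  by case: nX => /covers_mem/andP[].
have xX : x \in X by rewrite mem_cat mem_head orbT.
have pX : path edge b X.
  have pXR : path edge x XR.
    by have [pA _ _ _] := th; move: pA; rewrite EA rcons_cat cat_path => /andP[].
  have pXL : path edge b (rcons XL x) by move: pB; rewrite EB rcons_cat cat_path => /andP[].
  by rewrite /X -cat_rcons cat_path last_rcons pXL.
set V := fun w => [|| w == a, w == b, w == z | w \in X].
have Na w : V w -> w != a -> oedge a w -> w = q.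
  rewrite /V => /or4P[/eqP->|/eqP->|/eqP->|wX] wa aw.
  - by rewrite eqxx in wa.
  - by rewrite (negPf st3) in aw.
  - by rewrite (negPf faz) in aw.
  - by apply/eqP; apply: contraTT aw; apply: st1.
have Nb w : V w -> w != b -> oedge b w -> w = p.
  rewrite /V => /or4P[/eqP->|/eqP->|/eqP->|wX] wb bw.
  - by rewrite oedge_sym (negPf st3) in bw.
  - by rewrite eqxx in wb.
  - by rewrite (negPf fbz) in bw.
  - by apply/eqP; apply: contraTT bw; apply: st2.
have Nz w : V w -> w != z -> oedge z w -> w = x.
  rewrite /V oedge_sym => /or4P[/eqP->|/eqP->|/eqP->|wX] wz zw.
  - by rewrite (negPf faz) in zw.
  - by rewrite (negPf fbz) in zw.
  - by rewrite eqxx in wz.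
  - by apply/eqP; apply: contraTT zw; apply: aX.
have edge_ne (u w : G) : edge u w -> w != u by move/edge_neq; rewrite eq_sym.
have [aq bp zx] : [/\ edge a q, edge b p & edge z x] by split; rewrite edge_sym.
apply: (@three_pendants G (mem X) a b z q p x) => //.
- by rewrite /= !inE negb_or ab az bz.
- by move=> w Vw aw; apply: Na; rewrite ?edge_ne ?edge_oedge.
- by move=> w Vw bw; apply: Nb; rewrite ?edge_ne ?edge_oedge.
- by move=> w Vw zw; apply: Nz; rewrite ?edge_ne ?edge_oedge.
- move=> u v Vu Vv uv ouv; have vu : v != u by rewrite eq_sym.
  have ovu : oedge v u by rewrite oedge_sym.
  have esym : edge v u -> edge u v by rewrite edge_sym.
  case/or4P: (Vu) => [/eqP E|/eqP E|/eqP E|uX].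
  + by rewrite E; rewrite E in Vv vu ouv; rewrite (Na v).
  + by rewrite E; rewrite E in Vv vu ouv; rewrite (Nb v).
  + by rewrite E; rewrite E in Vv vu ouv; rewrite (Nz v).
  case/or4P: (Vv) => [/eqP E|/eqP E|/eqP E|vX]; try apply: esym.
  + by rewrite E; rewrite E in Vu uv ovu; rewrite (Na u).
  + by rewrite E; rewrite E in Vu uv ovu; rewrite (Nb u).
  + by rewrite E; rewrite E in Vu uv ovu; rewrite (Nz u).
  + exact: lX.
- move=> u v; case E: X pX => [|h s] pX uX vX; first by rewrite E in xX.
  by case/andP: pX => _ /path_connected; apply.
Qed.

(** Splitting clause of [nice] at [x] itself: in the other alternative both paths would contain [x].
    Thus the rest of [X] is covered by a path from [p] to [q]. *)
Lemma stuck_bypass : covers2 x x p q X.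
Proof.
have [_ qx _] := stuck_triangle; have [_ _ _ [n2 _ _]] := nX.
have xX : x \in X by rewrite mem_cat mem_head orbT.
have unX : uniq X.
  have [unC _] := theta_uniq th; move: unC; rewrite -(perm_uniq permC) cat_uniq.
  by case/andP.
have xq : x != q by rewrite eq_sym edge_neq.
case: (n2 x xX xq) => // -[s1 [s2 [/covers_mem/andP[x1 _] /covers_mem/andP[_ x2] pe]]].
move: unX; rewrite -(perm_uniq pe) cat_uniq => /and3P[_ /hasPn h _].
by move: (h x x2); rewrite /= x1.
Qed.

(** The triangle [p q x] has the pendant vertices [b] at [p] and [a] at [q]. A tail of length 2 at
    [x] completes [N112]; where none is found, a deer appears. *)
Lemma stuck_absurd : tame x A y B R -> False.
Proof.
have [qp qx px] := stuck_triangle; have [A0 B0] := stuck_nonnil.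
have [qa pb] := stuck_edges; have [st1 st2 nab] := stX.
have [s1 [s2 [hs1 hs2 pes]]] := stuck_bypass.
have [n0 hXp hXq [_ _ n4]] := nX.
have [[X1 [peX1 hX1]] [X2 [peX2 hX2]]] :
    (exists X1, perm_eq X (q :: X1) /\ covers x p X1) /\
    (exists X2, perm_eq X (p :: X2) /\ covers x q X2).
  by case: n4 => // -[_ _ Eq]; move: qx; rewrite /q Eq edge_irrefl.
have [hp hq] := andP (covers_mem n0); rewrite -/X in hp hq.
have xX : x \in X by rewrite mem_cat mem_head orbT.
have far_sym (u v : G) : ~~ oedge u v -> ~~ oedge v u by rewrite oedge_sym.
have ne_qp := edge_neq qp; have ne_qx := edge_neq qx; have ne_px := edge_neq px.
have pa : ~~ oedge p a by apply/far_sym/st1; rewrite // eq_sym.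
have xa : ~~ oedge x a by apply/far_sym/st1; rewrite // eq_sym.
have qb : ~~ oedge q b by apply/far_sym/st2.
have xb : ~~ oedge x b by apply/far_sym/st2; rewrite // eq_sym.
have far r : r \in R -> [/\ ~~ oedge p r, ~~ oedge q r, ~~ oedge a r & ~~ oedge b r].
  move=> rR; have [? ?] := stuck_far rR.
  by split=> //; apply: aX.
have pq : edge p q by rewrite edge_sym.
have nba := far_sym _ _ nab.
have [pA pB pR _] := th.
case=> [[z ER]|[one nxR _]]; last first.
  (* A single vertex in [R] would have the two neighbours [x] and [y] on the cycle, which is
     excluded here. So the tail at [x] is [z1 z2]. *)
  case: R th aX pR far one nxR => [|z1 [|z2 R']] th' aX' pR' far' one nxR'.
  - by case: th' => _ _ _ [].
  - move: pR'; rewrite /= andbT => /andP[xz zy]; rewrite edge_sym in xz.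
    have xy := one z1 x y (mem_head _ _) (mem_head _ _) _ xz zy.
    have [unC _] := theta_uniq th'; move: unC; rewrite -{1}xy.
      by rewrite cons_uniq mem_cat mem_head orbT.
    by rewrite inE mem_cat mem_head !orbT.
  have z2R : z2 \in [:: z1, z2 & R'] by rewrite !inE eqxx orbT.
  have [f1 f2 f3 f4] := far' z1 (mem_head _ _).
  have [g1 g2 g3 g4] := far' z2 z2R.
  have [xz1 z12] : edge x z1 /\ edge z1 z2 by case/and3P: pR'.
  have xz2 := tail_light max_cycle hclaw th' nxR' (fun u v => one z2 u v z2R).
  exact: (@N112_oedge G p q x b a z1 z2 hN).
have zR : z \in R by rewrite ER mem_head.
have [pz qz az bz] := far z zR.
have [xz zy] : edge x z /\ edge z y by move: pR; rewrite ER => /and3P[].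
have close := theta_close max_cycle th.
(* [c] and [d] are the neighbours of [y] on the cycle, [d1] is the vertex after [d]. *)
have [c [A5 EA5]] : exists c A5, A3 = rcons A5 c by case/lastP: (A3) A0 => // A5 c _; exists c, A5.
have [d [B5 EB5]] : exists d B5, B3 = d :: B5 by case: (B3) B0 => // d B5 _; exists d, B5.
have cd : oedge c d.
  have := shortcut max_cycle hclaw (theta_swap th).
  by rewrite EA EB EB5 EA5 last_cat last_rcons.
have dc : oedge d c by rewrite oedge_sym.
have lA5 : path oedge q (rcons A5 c).
  by apply: edge_path; move: linkA; rewrite EA5 rcons_path => /andP[].
have lB5 : path oedge d (rcons B5 p) by apply: edge_path; move: linkB; rewrite EB5 => /andP[].
have [cy yd] : edge c y /\ edge y d.
  split; last by move: linkB; rewrite EB5 => /andP[].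
  by move: linkA; rewrite EA5 rcons_path last_rcons => /andP[].
have oyd := edge_oedge yd; have ody : oedge d y by rewrite oedge_sym.
have hA3 : covers a c A3.
  have lc : last c A3 = c by rewrite EA5 last_rcons.
  by have := covers_segment c linkA A0; rewrite lc.
have hB3 : covers d b B3.
  have hd : head p B3 = d by rewrite EB5.
  by have := covers_segment y linkB B0; rewrite hd.
have peA3 : perm_eq A3 (A5 ++ [:: c]) by rewrite EA5 cats1.
have peB3 : perm_eq B3 (d :: B5) by rewrite EB5.
have peC := permC.
(* The o-edge between [c] and [d] bypasses [y]; an o-edge from [q], [p], [a] or [b] to [y] would let
   a path covering the cycle end there. *)
have qy : ~~ oedge q y.
  apply/negP => qy; apply: (close _ (covers_link_rev hX1 lB5 (covers_link_rev
    (covers_cat (covers1 d) dc (covers1 c)) lA5 (covers_rcons (covers1 q) qy)))); perm_count.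
have py : ~~ oedge p y.
  apply/negP => py; apply: (close _ (covers_link hX2 lA5 (covers_link
    (covers_cat (covers1 c) cd (covers1 d)) lB5 (covers_rcons (covers1 p) py)))); perm_count.
have ay : ~~ oedge a y.
  apply/negP => ay; apply: (close _ (covers_rcons (covers_link_rev hXp lB5
    (covers_cat (covers1 d) dc (covers_sym hA3))) ay)); perm_count.
have b_y : ~~ oedge b y.
  apply/negP => b_y; apply: (close _ (covers_rcons (covers_link hXq lA5
    (covers_cat (covers1 c) cd hB3)) b_y)); perm_count.
(* If [x] and [y] are not adjacent, the tail at [x] is [z y]. *)
have [xy|nxy] := boolP (edge x y); last first.
  have th1 := th; rewrite ER in th1.
  have nxy' := ends_light max_cycle hclaw th1 nxy.
  exact: (@N112_oedge G p q x b a z y hN).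
(* [a] differs from [c], which is adjacent to [y]; likewise [b] differs from [d]. *)
have [A6 EA6] : exists A6, A5 = a :: A6.
  have := EA5; rewrite /a; case: (A5) => [|a' A6] E; last by rewrite E; exists A6.
  by move: ay; rewrite /a E /= edge_oedge.
have [B6 EB6] : exists B6, B5 = rcons B6 b.
  have := EB5; rewrite /b; case/lastP: (B5) => [|B6 b'] E.
    by move: b_y; rewrite /b E /= edge_oedge // edge_sym.
  by rewrite E /= last_rcons; exists B6.
have [d1 [B7 EB7]] : exists d1 B7, B5 = d1 :: B7.
  by rewrite EB6; case: (B6) => [|d1 B7]; [exists b, [::]|exists d1, (rcons B7 b)].
have lA6 : path oedge a (rcons A6 c) by move: lA5; rewrite EA6 => /andP[].
have lA3 : path oedge q (rcons A3 y) := edge_path linkA.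
have lB7 : path oedge d1 (rcons B7 p) by move: lB5; rewrite EB7 => /andP[].
have dd1 : edge d d1 by move: linkB; rewrite EB5 EB7 => /and3P[].
have hB5 : covers d1 b B5.
  rewrite /b EB5 EB7 /=; apply: covers_path; move: lB7; rewrite rcons_path.
  by case/andP.
have peA5 : perm_eq A5 (a :: A6) by rewrite EA6.
have peB5 : perm_eq B5 (d1 :: B7) by rewrite EB7.
(* The path would go from [x] to [d], along the cycle to [p], through the rest of [X] to [q] by
   [stuck_bypass], and on to [y]. *)
have xd : ~~ oedge x d.
  apply/negP => xd; apply: (close _ (covers_cat hs1 xd (covers_link (covers1 d) lB5
    (covers_link hs2 lA3 (covers1 y))))); perm_count.
have qd : ~~ oedge q d.
  apply/negP; rewrite oedge_sym => dq; apply: (close _ (covers_link_rev hX1 lB5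
    (covers_cat (covers1 d) dq (covers_link (covers1 q) lA3 (covers1 y))))); perm_count.
have ad : ~~ oedge a d.
  have lA4 : path oedge a (rcons (A6 ++ [:: c]) y).
    by move: lA3; rewrite EA5 EA6 cats1 => /andP[].
  apply/negP; rewrite oedge_sym => da; apply: (close _ (covers_link_rev hXp lB5
    (covers_cat (covers1 d) da (covers_link (covers1 a) lA4 (covers1 y))))); perm_count.
(* If [d1] is o-adjacent to [y], then [d] has no o-edge to [p] or [b], and the tail at [x] is [y d].
   Otherwise the triangle [x y z] with tails [q a] and [d d1] is a deer. *)
have [d1y|nd1y] := boolP (oedge d1 y).
  have pd : ~~ oedge p d.
    apply/negP; rewrite oedge_sym => dp; apply: (close _ (covers_link hX2 lA5
      (covers_cat (covers1 c) cd (covers_cat (covers1 d) dp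
      (covers_link_rev (covers1 p) lB7 (covers_rcons (covers1 d1) d1y)))))); perm_count.
  have bd : ~~ oedge b d.
    apply/negP; rewrite oedge_sym => db; apply: (close _ (covers_link hXq lA5
      (covers_cat (covers1 c) cd (covers_cat (covers1 d) db
      (covers_rcons (covers_sym hB5) d1y))))); perm_count.
  exact: (@N112_oedge G p q x b a y d hN).
have zd : ~~ oedge d z.
  have ths := theta_swap th; rewrite EB EB5 ER in ths.
  exact: (nbr_far max_cycle ths (mem_head z [::])).
have zd1 : ~~ oedge d1 z.
  have ths := theta_swap th; rewrite ER in ths.
  apply/negP => d1z; apply: (theta_close_at max_cycle ths (mem_head z [::])
    (covers_cat (covers1 y) oyd (covers_cat (covers1 d) dc (covers_link_rev (covers1 c) lA5
    (covers_link_rev (covers_sym n0) lB7 (covers1 d1))))) d1z); perm_count.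
have xd1 : ~~ oedge x d1.
  apply/negP; rewrite oedge_sym => d1x; apply: (close _ (covers_sym
    (covers_cat (covers1 y) oyd (covers_cat (covers1 d) dc (covers_link_rev (covers1 c) lA5
    (covers_link_rev (covers_sym hs2) lB7 (covers_cat (covers1 d1) d1x hs1))))))); perm_count.
have qd1 : ~~ oedge q d1.
  apply/negP; rewrite oedge_sym => d1q; apply: (close _ (covers_link_rev hX1 lB7
    (covers_cat (covers1 d1) d1q (covers_link (covers1 q) lA5
    (covers_cat (covers1 c) cd (covers_rcons (covers1 d) ody)))))); perm_count.
have ad1 : ~~ oedge a d1.
  apply/negP; rewrite oedge_sym => d1a; apply: (close _ (covers_link_rev hXp lB7
    (covers_cat (covers1 d1) d1a (covers_link (covers1 a) lA6
    (covers_cat (covers1 c) cd (covers_rcons (covers1 d) ody)))))); perm_count.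
have xq : edge x q by rewrite edge_sym.
have yz : edge y z by rewrite edge_sym.
by apply: (@deer_oedge G x y z q a d d1 hdeer) => //; apply: far_sym.
Qed.

End Endgame.
End Stuck.

(** * Proof of the theorem *)

Section Existence.
Variable G : sgraph.
Implicit Types (u v x y z r : G) (s A B C R : seq G).

Lemma avoiding_path (X : {set G}) u v : k_connected 2 G -> #|X| < 2 ->
  u \notin X -> v \notin X ->
  exists s, [/\ path edge u s, last u s = v & forall w, w \in s -> w \notin X].
Proof.
move=> [_ conn] lt uX vX; have [_ /(_ _ _)] := conn X lt.
have uX' : u \in ~: X by rewrite inE.
have vX' : v \in ~: X by rewrite inE.
move=> /(_ (exist _ u uX') (exist _ v vX')) /connectP[s ps E].
exists (map val s); split.
- rewrite -[u]/(val (exist (fun x => x \in ~: X) u uX')) path_map.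
  exact: ps.
- by rewrite (last_map val s (exist _ u uX')) -E.
- by move=> w /mapP[w' _ ->]; have := valP w'; rewrite inE.
Qed.

Lemma first_hit (P : pred G) u s : P (last u s) -> ~~ P u -> path edge u s ->
  exists s1 w, [/\ path edge u (rcons s1 w), P w, all (predC P) s1 & w \in s].
Proof.
elim: s u => [|v s IH] u /=; first by move=> ->.
have [Pv _ _ /andP[uv _]|nPv Pl _ /andP[uv ps]] := boolP (P v).
  by exists [::], v; rewrite /= uv Pv mem_head.
have [s1 [w [p1 Pw a1 ws]]] := IH v Pl nPv ps.
by exists (v :: s1), w; split; rewrite //= ?uv ?nPv // inE ws orbT.
Qed.

Lemma not_uniq_split s : ~~ uniq s -> exists s1 r s2 s3, s = s1 ++ r :: s2 ++ r :: s3.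
Proof.
elim: s => //= u s IH; rewrite negb_and negbK; have [us _|_ /=] := boolP (u \in s).
  by case/splitPr: us => s2 s3; exists [::], u, s2, s3.
by case/IH => s1 [r [s2 [s3 ->]]]; exists (u :: s1), r, s2, s3.
Qed.

Definition detour C x y R : bool :=
  [&& x \in C, y \in C, x != y, R != [::], path edge x (rcons R y) & all (fun r => r \notin C) R].

Lemma detour_rev C x y R : detour C x y R -> detour C y x (rev R).
Proof.
case/and5P=> xC yC xy R0 /andP[pR aR]; apply/and5P; split=> //; first by rewrite eq_sym.
  by rewrite -size_eq0 size_rev size_eq0.
by rewrite edge_path_rev // all_rev.
Qed.

(** Walk from [v] until the cycle is hit, at [x], then again from [v] avoiding [x], and glue the
    walks at [v]. Repeated vertices do no harm, as a shortest detour is chosen later. *)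
Lemma detour_exists C v : k_connected 2 G -> uniq C -> 1 < size C -> v \notin C ->
  exists x y R, detour C x y R.
Proof.
move=> hG unC szC vC.
have [c0 c0C] : exists c0 : G, c0 \in C by case: C szC {unC vC} => // c0 C _; exists c0; rewrite mem_head.
have [|||s [ps ls _]] := @avoiding_path set0 v c0 hG; rewrite ?cards0 ?inE //.
have [|x_R1 [x [pR1 xC aR1 _]]] := @first_hit (mem C) v s _ vC ps; first by rewrite ls.
have [y0 [y0C y0x]] : exists y0 : G, y0 \in C /\ y0 != x.
  case: C unC szC {c0C vC ps ls xC aR1 c0 s} => // a [|b C] //= /andP[ab _] _.
  have [Ea|na] := eqVneq a x; last by exists a; rewrite mem_head.
  exists b; split; first by rewrite !inE eqxx orbT.
  by rewrite -Ea; apply: contraNneq ab => ->; rewrite mem_head.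
have vx : v != x by apply: contraNneq vC => ->.
have [|||t [pt lt xt]] := @avoiding_path [set x] v y0 hG; rewrite ?cards1 ?inE //.
have [|R2 [y [pR2 yC aR2 yt]]] := @first_hit (mem C) v t _ vC pt; first by rewrite lt.
exists x, y, (rev x_R1 ++ v :: R2); apply/and5P; split=> //.
- by have := xt y yt; rewrite inE eq_sym.
- by case: (rev x_R1).
apply/andP; split.
  rewrite rcons_cat -[rcons (v :: R2) y]/(v :: rcons R2 y) -cat_rcons cat_path last_rcons pR2.
  by rewrite andbT edge_path_rev.
by rewrite all_cat all_rev /= vC; apply/andP.
Qed.

Lemma shortest_detour C : (exists x y R, detour C x y R) ->
  exists x y R, detour C x y R /\ forall x' y' R', detour C x' y' R' -> size R <= size R'.
Proof.
move=> [x0 [y0 [R0 h0]]].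
pose P n := [exists x, exists y, exists t : n.-tuple G, detour C x y t].
have exP x y R : detour C x y R -> P (size R).
  by move=> h; apply/existsP; exists x; apply/existsP; exists y; apply/existsP; exists (in_tuple R).
case: (ex_minnP (ex_intro P _ (exP _ _ _ h0))) => n /existsP[x /existsP[y /existsP[t ht]]] min.
by exists x, y, t; split=> // x' y' R' /exP; rewrite size_tuple; apply: min.
Qed.

Lemma shortest_detour_chord C x y R r : detour C x y R ->
  (forall x' y' R', detour C x' y' R' -> size R <= size R') -> r \in behead R -> ~~ edge x r.
Proof.
move=> /and5P[xC yC xy _ /andP[pR aR]] min; case: R pR aR min => //= z R /andP[_ pR] /andP[_ aR] min rR.
apply/negP => xr; case/splitPr: rR pR aR min => R1 R2 pR aR min.
have := min x y (r :: R2); rewrite /= size_cat /= => h.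
suff : (size R1 + (size R2).+1).+1 <= (size R2).+1 by clear; lia.
apply: h; apply/and5P; split=> //=; rewrite xr /=.
move: pR aR; rewrite rcons_cat -[rcons (_ :: _) _]/(r :: rcons R2 y) cat_path all_cat /=.
by move=> /and3P[_ _ ->] /and3P[_ -> ->].
Qed.

Lemma theta_exists N C v : k_connected 2 G -> uniq C -> cycle edge C -> size C = N -> 1 < N ->
  v \notin C -> exists x A y B R, theta N x A y B R /\ tame x A y B R.
Proof.
move=> hG unC cyC szC N1 vC.
have [|x [y [R [hR min]]]] := shortest_detour (detour_exists hG unC _ vC); first by rewrite szC.
have := hR => /and5P[xC yC xy R0 /andP[pR aR]].
have unR : uniq R.
  apply/negPn/negP => /not_uniq_split [s1 [r [s2 [s3 ER]]]].
  have := min x y (s1 ++ r :: s3); rewrite ER !size_cat /= size_cat /= => h.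
  suff : size s1 + (size s2 + (size s3).+1).+1 <= size s1 + (size s3).+1 by clear; lia.
  apply: h; apply/and5P; split=> //; first by case: (s1).
  move: pR aR; rewrite ER !rcons_cat /= !rcons_cat !cat_path /= !cat_path !all_cat /= !all_cat /=.
  by move=> /and4P[-> -> _ /andP[_ ->]] /and4P[-> -> _ /andP[_ ->]].
have [i s Es] := rot_to xC.
have ys : y \in s.
  have : y \in rot i C by rewrite mem_rot.
  by rewrite Es inE eq_sym (negPf xy).
case/splitPr: ys Es => A B Es.
have memC w : (w \in x :: A ++ y :: B) = (w \in C) by rewrite -Es mem_rot.
exists x, A, y, B, R; split.
  have : path edge x (rcons (A ++ y :: B) x) by rewrite -(rot_cycle i) Es in cyC.
  rewrite rcons_cat -[rcons (y :: B) x]/(y :: rcons B x) -cat_rcons cat_path last_rcons.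
  case/andP=> pA pB; split=> //; split=> //.
  - suff : uniq ((x :: A ++ y :: B) ++ R) by rewrite /= -catA.
    rewrite cat_uniq -Es rot_uniq unC unR andbT; apply/hasPn => r rR.
    by rewrite /= mem_rot; exact: (allP aR).
  - by have := congr1 size Es; rewrite size_rot szC => ->; rewrite /= size_cat /=; clear; lia.
have [R1|R2] := leqP (size R) 1.
  by left; case: R R0 R1 {hR min pR aR unR} => // z [|] // _ _; exists z.
right; split=> [r u w rR|r|r].
(* A vertex of [R] with two neighbours on the cycle would by itself be a shorter detour. *)
- rewrite !memC => uC wC ru rw; apply/eqP/negPn/negP => uw.
  have ur : edge u r by rewrite edge_sym.
  have := min u w [:: r]; rewrite /detour uC wC uw /= ur rw (allP aR _ rR).
  by move=> /(_ isT); rewrite leqNgt R2.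
- exact: shortest_detour_chord hR min.
- apply: shortest_detour_chord (detour_rev hR) _ => x' y' R'; rewrite size_rev; exact: min.
Qed.

End Existence.

Lemma tame_swap (G : sgraph) (x y : G) A B R : tame x A y B R -> tame y B x A (rev R).
Proof.
case=> [[z ->]|[one nx ny]]; first by left; exists z.
have memC w : (w \in y :: B ++ x :: A) = (w \in x :: A ++ y :: B).
  by apply: perm_mem; perm_count.
right; split=> [r u v||]; rewrite ?revK //.
by rewrite mem_rev !memC; apply: one.
Qed.

Lemma nice_segment1 (G : sgraph) (x : G) : nice_segment x [::] [::].
Proof. exact: nice1. Qed.

(** First [x] grows against the segment [[:: y]]; if it becomes good, [y] grows against the result.
    A stuck segment is refuted by [stuck_absurd], two good ones by [two_good]. *)
Lemma theta_absurd (G : sgraph) N (x y : G) A B R :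
  (forall C : seq G, uniq C -> cycle oedge C -> 1 < size C -> size C <= N) ->
  graph_heavy claw G -> graph_heavy N112 G -> graph_heavy deer G ->
  theta N x A y B R -> tame x A y B R -> False.
Proof.
move=> max hclaw hN hdeer th tm.
have init_light (u : G) : light [:: u].
  by move=> v w; rewrite !inE => /eqP-> /eqP->; rewrite eqxx.
have init_apart (u : G) S : apart u S [:: u] by move=> r v _; rewrite inE => /eqP->; rewrite eqxx.
have EA0 : A = [::] ++ A ++ [::] by rewrite cats0.
have EB0 : B = [::] ++ B ++ [::] by rewrite cats0.
have [[XL [XR [A2 [B2 [EA EB nX gX]]]]]|[XL [XR [A3 [B3 [EA EB nX lX [aX stX]]]]]]] :=
  grow max th (nice_segment1 y) (ltnSn _) EA0 EB0 (nice_segment1 x) (init_light x) (init_apart x R); last first.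
  exact: (stuck_absurd max hclaw hN hdeer th EA EB nX lX aX stX tm).
have ths := theta_swap th.
have EB0' : B = [::] ++ B2 ++ XL by [].
have EA0' : A = XR ++ A2 ++ [::] by [].
have [[YL [YR [A2' [B2' [EB' EA' nY gY]]]]]|[YL [YR [A3 [B3 [EB' EA' nY lY [aY stY]]]]]]] :=
  grow max ths nX (ltnSn _) EB0' EA0' (nice_segment1 y) (init_light y) (init_apart y (rev R)); last first.
  exact: (stuck_absurd max hclaw hN hdeer ths EB' EA' nY lY aY stY (tame_swap tm)).
have [pA pB _ _] := th.
have l1 : path oedge (last x XR) (rcons B2' (head y YL)).
  by apply/edge_path/(@split_link _ x y); rewrite -EA'.
have l2 : path oedge (last y YR) (rcons A2' (head x XL)).
  by apply/edge_path/(@split_link _ y x); rewrite -EB'.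
apply: (two_good max th _ l1 l2 gX gY).
by rewrite [in X in perm_eq _ X]EA' [in X in perm_eq _ X]EB'; perm_count.
Qed.

Theorem theorem8 (G : sgraph) :
  k_connected 2 G ->
  family_heavy [:: claw; N112; deer] G ->
  hamiltonian G.
Proof.
move=> hG heavy.
have hclaw : graph_heavy claw G by apply: heavy; left.
have hN : graph_heavy N112 G by apply: heavy; right; left.
have hdeer : graph_heavy deer G by apply: heavy; right; right; left.
have G2 : 2 < #|G| by case: hG.
pose P n := (1 < n) && [exists t : n.-tuple G, uniq t && cycle edge t].
have exP (c : seq G) : uniq c -> cycle edge c -> 1 < size c -> P (size c).
  by move=> un cy sz; rewrite /P sz; apply/existsP; exists (in_tuple c); rewrite /= un.
have [u [v uv]] : exists u v : G, edge u v.
  have [u [v uv]] : exists u v : G, u != v.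
    have /card_gt1P[u [v [_ _ uv]]] : 1 < #|G| by apply: ltnW.
    by exists u, v.
  have [|||[|w s] [ps ls _]] := @avoiding_path G set0 u v hG; rewrite ?cards0 ?inE //.
    by move: uv; rewrite -ls eqxx.
  by exists u, w; case/andP: ps.
have P2 : P 2.
  by apply: (exP [:: u; v]); rewrite //= ?inE ?edge_neq // uv edge_sym uv.
have leP n : P n -> n <= #|G|.
  case/andP=> _ /existsP[t /andP[un _]].
  by rewrite -(size_tuple t) -(card_uniqP un) max_card.
case: (ex_maxnP (ex_intro P 2 P2) leP) => N /andP[N1 /existsP[C /andP[unC cyC]]] maxN.
(* By [ore_cycle], the maximum over cycles of [G] also bounds cycles of o-edges. *)
have max (c : seq G) : uniq c -> cycle oedge c -> 1 < size c -> size c <= N.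
  move=> un cy sz; have [c' [un' cy' le]] := ore_cycle un cy sz.
  exact: leq_trans le (maxN _ (exP _ un' cy' (leq_trans sz le))).
have [/forallP all|/forallPn[w wC]] := boolP [forall w, w \in C]; last first.
  have [x [A [y [B [R [th tm]]]]]] := theta_exists hG unC cyC (size_tuple C) N1 wC.
  by case: (theta_absurd max hclaw hN hdeer th tm).
(* The cycle has more than two vertices because it contains all those of [G]. *)
exists C; split=> //; apply: leq_trans G2 _.
rewrite -(card_uniqP unC); apply/subset_leq_card/subsetP => w _; exact: all.
Qed.
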